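(* For every graph $G$, $\overline{mnk}(\overline{DG})\leq 2\cdot mnk(G)$.
   Context: Graphs are finite and embeddings are (tame) embeddings in $\mathbb{R}^3$. For an undirected graph $G$, $\overline{DG}$ is the symmetric digraph formed by replacing each edge $v_1v_2$ of $G$ with the two directed edges $v_1v_2$ and $v_2v_1$. A cycle in a digraph is consistently oriented if it is a directed cycle (a pair of oppositely directed edges $uv$, $vu$ is a consistently oriented 2-cycle). $mnk(G)$ denotes the minimum, over all embeddings of $G$, of the number of distinct cycles of $G$ whose images are non-trivial knots. For a digraph $\overline{G}$, $\overline{mnk}(\overline{G})$ denotes the minimum, over all embeddings of $\overline{G}$, of the number of distinct consistently oriented cycles of $\overline{G}$ whose images are non-trivial knots. *)

(* Defs.v *)
From HB Require Import structures.
From mathcomp Require Import all_boot all_order all_algebra.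
From mathcomp Require Import all_classical all_reals all_analysis.
Import Order.TTheory GRing.Theory Num.Theory.
Import numFieldNormedType.Exports.

Set Implicit Arguments.
Unset Strict Implicit.
Unset Printing Implicit Defensive.

Local Open Scope classical_set_scope.
Local Open Scope ring_scope.

(** * Finite graphs and digraphs *)

(* Multiple edges and loops are allowed.  The graph is undirected: the order of
   the pair [ends e] is only a way of naming the endpoints of [e], and a cycle
   may traverse [e] in either direction. *)
Record graph := Graph {
  vertex : finType;
  edge : finType;
  ends : edge -> vertex * vertex }.

Record digraph := Digraph {
  dvertex : finType;
  darc : finType;
  source : darc -> dvertex;
  target : darc -> dvertex }.

Definition underlying (D : digraph) : graph :=
  @Graph (dvertex D) (darc D) (fun a => (source a, target a)).

(* The symmetric digraph of G: an edge e joining v1 and v2 gives the two arcs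
   (e, true) from v1 to v2 and (e, false) from v2 to v1. *)
Definition symmetric_digraph (G : graph) : digraph :=
  @Digraph (vertex G) (edge G * bool)%type
    (fun a => if a.2 then (ends a.1).1 else (ends a.1).2)
    (fun a => if a.2 then (ends a.1).2 else (ends a.1).1).

(* Cycles are subgraphs, identified with their sets of edges.  [ordS i] is the
   cyclic successor of the index [i], and the length of the cycle is [n.+1]. *)
Definition is_cycle (G : graph) (C : {set edge G}) : Prop :=
  exists (n : nat) (v : 'I_n.+1 -> vertex G) (e : 'I_n.+1 -> edge G),
    [/\ injective v, injective e,
        forall i, ends (e i) = (v i, v (ordS i)) \/
                  ends (e i) = (v (ordS i), v i)
      & C = [set e i | i : 'I_n.+1]%SET].

Definition is_directed_cycle (D : digraph) (C : {set darc D}) : Prop :=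
  exists (n : nat) (v : 'I_n.+1 -> dvertex D) (a : 'I_n.+1 -> darc D),
    [/\ injective v, injective a,
        forall i, source (a i) = v i /\ target (a i) = v (ordS i)
      & C = [set a i | i : 'I_n.+1]%SET].

(** * Ambient isotopy in 3-space *)

Section Space.
Variable R : realType.
Local Notation R3 := 'rV[R]_3.

Definition homeomorphism (h : R3 -> R3) : Prop :=
  continuous h /\ exists2 g : R3 -> R3, continuous g & cancel h g /\ cancel g h.

Definition ambient_isotopy (H : R -> R3 -> R3) : Prop :=
  [/\ {within `[0, 1] `*` [set: R3],
        continuous (fun p : R * R3 => H p.1 p.2)},
      forall x, H 0 x = x
    & forall t, 0 <= t <= 1 -> homeomorphism (H t)].

Definition standard_circle : set R3 :=
  [set x | x ord0 (inord 0) ^+ 2 + x ord0 (inord 1) ^+ 2 = 1 /\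
           x ord0 (inord 2) = 0].

Definition trivial_knot (K : set R3) : Prop :=
  exists2 H, ambient_isotopy H & H 1 @` K = standard_circle.

Definition segment (a b : R3) : set R3 :=
  [set (1 - t) *: a + t *: b | t in `[0, 1]].

Definition polygonal (A : set R3) : Prop :=
  exists s : seq (R3 * R3), A = \bigcup_(p in [set` s]) segment p.1 p.2.

(** * Embeddings of graphs *)

(* A continuous injection of the (compact) geometric realization of G into
   3-space, given by its restrictions to the vertices and to the edges, each
   edge being parametrized by [0, 1]. *)
Record embedding (G : graph) := Embedding {
  pos : vertex G -> R3;
  edge_path : edge G -> R -> R3;
  edge_path_continuous : forall e, {within `[0, 1], continuous (edge_path e)};
  edge_path0 : forall e, edge_path e 0 = pos (ends e).1;
  edge_path1 : forall e, edge_path e 1 = pos (ends e).2;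
  pos_inj : injective pos;
  edge_path_inj : forall e e' t t', 0 < t < 1 -> 0 < t' < 1 ->
    edge_path e t = edge_path e' t' -> e = e' /\ t = t';
  edge_path_pos : forall e t v, 0 < t < 1 -> edge_path e t <> pos v }.

Definition edge_image (G : graph) (f : embedding G) (e : edge G) : set R3 :=
  edge_path f e @` `[0, 1].

Definition cycle_image (G : graph) (f : embedding G) (C : {set edge G}) :
  set R3 := \bigcup_(e in [set` C]) edge_image f e.

(* Ambient isotopic to an embedding all of whose edges are polygonal. *)
Definition tame (G : graph) (f : embedding G) : Prop :=
  exists2 H, ambient_isotopy H &
    forall e : edge G, polygonal (H 1 @` edge_image f e).

Definition knotted (G : graph) (f : embedding G) (C : {set edge G}) : Prop :=
  ~ trivial_knot (cycle_image f C).

Definition knot_count (G : graph) (f : embedding G) : nat :=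
  #|[set C : {set edge G} | `[< is_cycle C /\ knotted f C >]]%SET|.

Definition directed_knot_count (D : digraph) (f : embedding (underlying D)) :
  nat :=
  #|[set C : {set darc D} | `[< is_directed_cycle C /\
       @knotted (underlying D) f C >]]%SET|.

End Space.

(* The minimum of a nonempty set of natural numbers (0 for the empty set). *)
Definition minimum (S : set nat) : nat :=
  xget 0%N [set n | S n /\ forall m, S m -> (n <= m)%N].

Lemma minimumP (S : set nat) : S !=set0 ->
  S (minimum S) /\ forall m, S m -> (minimum S <= m)%N.
Proof.
move=> [n0 Sn0]; rewrite /minimum; case: xgetP => [n _ //|].
have ex : exists n, `[< S n >] by exists n0; apply/asboolP.
case: (ex_minnP ex) => n /asboolP Sn nmin /(_ n) [].
by split=> // m /asboolP/nmin.
Qed.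

Definition mnk (R : realType) (G : graph) : nat :=
  minimum [set knot_count f | f in [set f : embedding R G | tame f]].

Definition directed_mnk (R : realType) (D : digraph) : nat :=
  minimum [set directed_knot_count f
          | f in [set f : embedding R (underlying D) | tame f]].

(* Main.v *)
(* Take a tame embedding of G with the least number of knotted cycles and move it
   so that its edges are polygonal.  Each edge e gets a parallel copy h(e), where h
   is a piecewise linear homeomorphism isotopic to the identity that fixes all the
   other edges; so replacing some edges of a cycle by their copies does not change
   the knot type.  If e is not a loop then h is chosen so that e and h(e) bound a
   disc: a piecewise linear homeomorphism takes e to a straight segment, and in
   these coordinates h pushes e along a fixed direction by the amount eps * rho,
   with rho >= 0 piecewise linear and vanishing exactly on the rest of the graph.
   Thus the directed 2-cycles are unknotted, and any other directed cycle has the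
   knot type of the cycle of G that it follows.  Each cycle of G is followed by at
   most two directed cycles.

   All the homeomorphisms are built from the maps x |-> x + f(x) u with f piecewise
   linear and of slope > -1 in the direction u; their inverses are of the same
   kind and x |-> x + t f(x) u is an isotopy from the identity. *)
Require Import Defs.
From HB Require Import structures.
From mathcomp Require Import all_boot all_order all_algebra.
From mathcomp Require Import all_classical all_reals all_analysis.
From mathcomp Require Import ring lra zify.
Import Order.TTheory GRing.Theory Num.Theory.
Import numFieldNormedType.Exports.

Set Implicit Arguments.
Unset Strict Implicit.
Unset Printing Implicit Defensive.

Local Open Scope classical_set_scope.
Local Open Scope ring_scope.

(** An edge is an arbitrary continuous path whose image happens to be a finite union of segments;
    the list of segments is not ordered along the path and its members may overlap. Straightening
    therefore cannot go from one segment to the next, and a supremum argument over the parameter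
    takes its place.

    The copies are made one edge at a time, each relative to the vertices, the other edges and the
    copies already present. Every new homeomorphism thus fixes all that the earlier ones produced,
    and one isotopy can carry out the replacements on any prescribed set of edges.

    A loop needs less than another edge: its two opposite arcs do not form a directed cycle, so
    nothing has to bound a disc.

    At most two directed cycles follow a given cycle because the direction of one arc propagates to
    the next: only one arc of a directed cycle ends at a given vertex. *)

Lemma continuous_pair (T U V : topologicalType) (f : T -> U) (g : T -> V) x :
  {for x, continuous f} -> {for x, continuous g} ->
  {for x, continuous (fun y => (f y, g y))}.
Proof. by move=> cf cg; exact: (cvg_pair cf cg). Qed.

Lemma continuous_fst (U V : topologicalType) : continuous (@fst U V).
Proof. by move=> p; exact: cvg_fst. Qed.

Lemma continuous_snd (U V : topologicalType) : continuous (@snd U V).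
Proof. by move=> p; exact: cvg_snd. Qed.

(** * Ambient isotopies *)

Section Isotopy.
Variable R : realType.
Local Notation R3 := 'rV[R]_3.
Implicit Types (h g : R3 -> R3) (A B K Z : set R3).

(** The retraction of the line onto the unit interval. Composing with it makes isotopies and paths
    given on [[0, 1]] continuous everywhere; it also cuts off the planar stretches used for
    bigons. *)
Definition clamp (t : R) : R := Num.max 0 (Num.min 1 t).

Lemma clamp_itv t : 0 <= clamp t <= 1.
Proof. by rewrite /clamp le_max lexx ge_max ler01 ge_min lexx. Qed.

Lemma clampE t : 0 <= t <= 1 -> clamp t = t.
Proof.
by move=> /andP[t0 t1]; rewrite /clamp (min_idPr t1) (max_idPr t0).
Qed.

Lemma clamp_continuous : continuous clamp.
Proof.
move=> t; apply: (@continuous_max R R (cst 0) (fun s => Num.min 1 s) t).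
  exact: cvg_cst.
apply: (@continuous_min R R (cst 1) id t); last exact: cvg_id.
exact: cvg_cst.
Qed.

Lemma within_clamp (U : topologicalType) (f : R -> U) :
  {within `[0, 1], continuous f} -> continuous (f \o clamp).
Proof.
move=> /subspace_continuousP cf t.
have ct : `[0, 1]%classic (clamp t) by rewrite /= in_itv /= clamp_itv.
move=> P /(cf _ ct)/(@clamp_continuous t) nP.
have {}nP : nbhs t [set s | `[0, 1]%classic (clamp s) -> P (f (clamp s))] := nP.
suff : nbhs t [set s | P (f (clamp s))] by [].
by apply: filterS nP => s; apply; rewrite /= in_itv /= clamp_itv.
Qed.

Lemma homeomorphism_id : homeomorphism (@idfun R3).
Proof. by split => // ; [move=> x|exists id] => //; move=> x. Qed.

Lemma homeomorphism_comp h g :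
  homeomorphism h -> homeomorphism g -> homeomorphism (h \o g).
Proof.
move=> [ch [h' ch' [hK h'K]]] [cg [g' cg' [gK g'K]]]; split.
  by move=> x; apply: continuous_comp; [exact: cg|exact: ch].
exists (g' \o h').
  by move=> x; apply: continuous_comp; [exact: ch'|exact: cg'].
by split => x /=; rewrite ?hK ?gK ?h'K ?g'K.
Qed.

Definition isotopic_to_id h : Prop :=
  exists2 H, ambient_isotopy H & H 1 = h.

(* Clamping the time makes the isotopy continuous on the whole of R x R3. *)
Lemma isotopic_to_idP h : isotopic_to_id h <-> exists H : R -> R3 -> R3,
  [/\ continuous (fun p : R * R3 => H p.1 p.2),
      forall x, H 0 x = x, forall t, homeomorphism (H t) & H 1 = h].
Proof.
split; last first.
  move=> [H [cH H0 Hh H1]]; exists H => //; split => //.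
  exact: continuous_subspaceT cH.
move=> [H [/subspace_continuousP cH H0 Hh] H1].
exists (fun t => H (clamp t)); split; last by rewrite clampE // ler01 lexx.
- move=> p.
  have ct : (`[0, 1] `*` [set: R3]) (clamp p.1, p.2).
    by split => //=; rewrite in_itv /= clamp_itv.
  move=> P /(cH _ ct) nP.
  have cc : {for p, continuous (fun q : R * R3 => (clamp q.1, q.2))}.
    apply: continuous_pair; last exact: continuous_snd.
    by apply: continuous_comp; [exact: continuous_fst|exact: clamp_continuous].
  have {}nP : nbhs p [set q : R * R3 | (`[0, 1] `*` setT) (clamp q.1, q.2) ->
    P (H (clamp q.1) q.2)] := cc _ nP.
  suff : nbhs p [set q : R * R3 | P (H (clamp q.1) q.2)] by [].
  apply: filterS nP => -[s x] /=; apply.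
  by split => //=; rewrite in_itv /= clamp_itv.
- by move=> x; rewrite clampE // ler01 lexx.
- by move=> t; apply: Hh; rewrite clamp_itv.
Qed.

Lemma isotopic_to_id_homeo h : isotopic_to_id h -> homeomorphism h.
Proof. by move=> [H [_ _ Hh] <-]; apply: Hh; rewrite ler01 lexx. Qed.

Lemma isotopic_to_id_comp h g :
  isotopic_to_id h -> isotopic_to_id g -> isotopic_to_id (h \o g).
Proof.
move=> /isotopic_to_idP[H [cH H0 Hh <-]] /isotopic_to_idP[G [cG G0 Gh <-]].
apply/isotopic_to_idP; exists (fun t => H t \o G t); split => //.
- move=> p.
  apply: (@continuous_comp _ _ _ (fun q : R * R3 => (q.1, G q.1 q.2))
     (fun q : R * R3 => H q.1 q.2)); last exact: cH.
  by apply: continuous_pair; [exact: continuous_fst|exact: cG].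
- by move=> x /=; rewrite G0 H0.
- by move=> t; apply: homeomorphism_comp.
Qed.

(* The inverse of H 1 is reached by running H backwards, H (1 - t) o (H 1)^-1,
   so that joint continuity of the inverses is not needed. *)
Lemma isotopic_to_id_inv h g : isotopic_to_id h -> cancel h g -> cancel g h ->
  isotopic_to_id g.
Proof.
move=> /isotopic_to_idP[H [cH H0 Hh <-]] hK gK.
have [_ [g' cg' [hK' g'K]]] := Hh 1.
have cg : continuous g.
  suff -> : g = g' by [].
  by apply/funext => x; rewrite -{1}(g'K x) hK.
apply/isotopic_to_idP; exists (fun t => H (1 - t) \o g); split.
- move=> p.
  apply: (@continuous_comp _ _ _ (fun q : R * R3 => (1 - q.1, g q.2))
     (fun q : R * R3 => H q.1 q.2)); last exact: cH.
  apply: continuous_pair.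
    by apply: cvgB; [exact: cvg_cst|exact: continuous_fst].
  by apply: continuous_comp; [exact: continuous_snd|exact: cg].
- by move=> x /=; rewrite subr0 gK.
- move=> t; apply: homeomorphism_comp => //; split => //.
  by exists (H 1) => //; have [] := Hh 1.
- by apply/funext => x /=; rewrite subrr H0.
Qed.

Lemma isotopic_to_id_id : isotopic_to_id idfun.
Proof.
apply/isotopic_to_idP; exists (fun=> idfun); split => //.
  exact: continuous_snd.
by move=> t; exact: homeomorphism_id.
Qed.

Lemma isotopic_to_id_inverse h : isotopic_to_id h ->
  exists2 g, isotopic_to_id g & cancel h g /\ cancel g h.
Proof.
move=> hh; have [_ [g _ [hK gK]]] := isotopic_to_id_homeo hh.
by exists g => //; exact: isotopic_to_id_inv hK gK.
Qed.

(** [D] is merely continuous, since this serves both the piecewise linear pushes and the curved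
    stretches that round a bigon into a circle. *)
Lemma isotopic_to_id_push (D : R3 -> R) (u : R3) : continuous D ->
  (forall t, 0 <= t <= 1 -> homeomorphism (fun x => x + (t * D x) *: u)) ->
  isotopic_to_id (fun x => x + D x *: u).
Proof.
move=> cD hD; exists (fun t x => x + (t * D x) *: u).
  split => //.
    apply: continuous_subspaceT => p.
    apply: cvgD; first exact: continuous_snd.
    apply: cvgZr_tmp; apply: cvgM; first exact: continuous_fst.
    by apply: continuous_comp; [exact: continuous_snd|exact: cD].
  by move=> x; rewrite mul0r scale0r addr0.
by apply/funext => x; rewrite mul1r.
Qed.

(** An isotopy taking the image to the circle, composed with that of [h], takes [K] there. The
    converse is the same fact for the inverse of [h]. *)
Lemma trivial_knot_homeo h K : isotopic_to_id h ->
  trivial_knot (h @` K) <-> trivial_knot K.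
Proof.
suff T g L : isotopic_to_id g -> trivial_knot (g @` L) -> trivial_knot L.
  move=> hh; split; first exact: T.
  have [g gg [hK gK]] := isotopic_to_id_inverse hh.
  move=> tK; apply: (T g) => //; rewrite image_comp.
  by rewrite (_ : g \o h = id) ?image_id //; apply/funext => x /=; rewrite hK.
move=> gg [H Hi HL].
have [|G Gi G1] := @isotopic_to_id_comp (H 1) g _ gg; first by exists H.
by exists G => //; rewrite G1 -image_comp.
Qed.

End Isotopy.

(** * Piecewise linear pushes *)

Section PiecewiseLinear.
Variable R : realType.
Local Notation R3 := 'rV[R]_3.
Implicit Types (h g : R3 -> R3) (f : R3 -> R) (A B K Z : set R3) (x y u : R3).

Definition dot (x y : R3) : R := \sum_i x ord0 i * y ord0 i.

Lemma dotDl x y u : dot (x + y) u = dot x u + dot y u.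
Proof.
by rewrite -big_split; apply: eq_bigr => i _; rewrite mxE mulrDl.
Qed.

Lemma dotZl (c : R) x u : dot (c *: x) u = c * dot x u.
Proof.
by rewrite mulr_sumr; apply: eq_bigr => i _; rewrite mxE mulrA.
Qed.

Lemma dotC x y : dot x y = dot y x.
Proof. by apply: eq_bigr => i _; rewrite mulrC. Qed.

Lemma dotNl x u : dot (- x) u = - dot x u.
Proof. by rewrite -scaleN1r dotZl mulN1r. Qed.

Lemma dotBl x y u : dot (x - y) u = dot x u - dot y u.
Proof. by rewrite dotDl dotNl. Qed.

Lemma dot0l u : dot 0 u = 0.
Proof. by rewrite -(scale0r 0) dotZl mul0r. Qed.

Lemma dotZr (c : R) x u : dot x (c *: u) = c * dot x u.
Proof. by rewrite dotC dotZl dotC. Qed.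

Lemma dotBr x y u : dot u (x - y) = dot u x - dot u y.
Proof. by rewrite ![dot u _]dotC dotBl. Qed.

Lemma dot_ge0 x : 0 <= dot x x.
Proof. by apply: sumr_ge0 => i _; rewrite -expr2 sqr_ge0. Qed.

Lemma dot_eq0 x : (dot x x == 0) = (x == 0).
Proof.
apply/idP/eqP => [|->]; last by rewrite dot0l.
rewrite psumr_eq0; last by move=> i _; rewrite -expr2 sqr_ge0.
move=> /allP x0; apply/rowP => i; rewrite mxE.
by have /x0 := mem_index_enum i; rewrite -expr2 sqrf_eq0 => /eqP.
Qed.

Lemma dot_gt0 x : x != 0 -> 0 < dot x x.
Proof. by move=> x0; rewrite lt_neqAle dot_ge0 eq_sym dot_eq0 x0. Qed.

Lemma dot_delta x i : dot x (delta_mx ord0 i) = x ord0 i.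
Proof.
rewrite /dot (bigD1 i) //= big1 ?addr0; first by rewrite mxE !eqxx mulr1.
by move=> j ji; rewrite mxE eqxx (negbTE ji) mulr0.
Qed.

Lemma dot_continuous u : continuous (dot^~ u).
Proof.
move=> x.
pose i1 : 'I_3 := lift ord0 ord0; pose i2 : 'I_3 := lift ord0 (lift ord0 ord0).
have -> : dot^~ u = fun y => y ord0 ord0 * u ord0 ord0 +
    (y ord0 i1 * u ord0 i1 + (y ord0 i2 * u ord0 i2 + 0)).
  by apply/funext => y; rewrite /dot !big_ord_recl big_ord0.
have C i c : {for x, continuous (fun y : R3 => y ord0 i * c)}.
  apply: (@continuousM R R3 (fun y => y ord0 i) (cst c) x).
    exact: coord_continuous.
  exact: cst_continuous.
exact: (cvgD (C _ _) (cvgD (C _ _) (cvgD (C _ _) (cvg_cst _)))).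
Qed.

(** Maxima and minima of affine functions are enough here, and both operations preserve the slope
    bound in a fixed direction and commute with solving for the inverse of a push. *)
Inductive pl : (R3 -> R) -> Prop :=
| pl_affine a c : pl (fun x => dot x a + c)
| pl_max f1 f2 : pl f1 -> pl f2 -> pl (f1 \max f2)
| pl_min f1 f2 : pl f1 -> pl f2 -> pl (f1 \min f2).

(* The slope bound makes [s |-> s + f (x + s u)] increasing, so that the push
   [x |-> x + f x u] is invertible. *)
Inductive plu u : (R3 -> R) -> Prop :=
| plu_affine a c : -1 < dot u a -> plu u (fun x => dot x a + c)
| plu_max f1 f2 : plu u f1 -> plu u f2 -> plu u (f1 \max f2)
| plu_min f1 f2 : plu u f1 -> plu u f2 -> plu u (f1 \min f2).

Lemma plu_pl u f : plu u f -> pl f.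
Proof.
by elim=> *; [exact: pl_affine|exact: pl_max|exact: pl_min].
Qed.

Lemma pl_continuous f : pl f -> continuous f.
Proof.
elim=> [a c|f1 f2 _ c1 _ c2|f1 f2 _ c1 _ c2] x.
- exact: (cvgD (@dot_continuous a x) (cvg_cst c)).
- exact: (@continuous_max R _ f1 f2 x (c1 x) (c2 x)).
- exact: (@continuous_min R _ f1 f2 x (c1 x) (c2 x)).
Qed.

Lemma pl_cst c : pl (cst c).
Proof.
suff -> : cst c = fun x : R3 => dot x 0 + c by exact: pl_affine.
by apply/funext => x; rewrite dotC dot0l add0r.
Qed.

Lemma plu_scale u f t : 0 <= t <= 1 -> plu u f -> plu u (fun x => t * f x).
Proof.
move=> /andP[t0 t1]; elim=> [a c ua|f1 f2 _ p1 _ p2|f1 f2 _ p1 _ p2].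
- suff -> : (fun x => t * (dot x a + c)) = (fun x => dot x (t *: a) + t * c).
    apply: plu_affine; rewrite dotZr.
    have [->|t_neq0] := eqVneq t 0; first by rewrite mul0r; lra.
    have tpos : 0 < t by rewrite lt_neqAle eq_sym t_neq0.
    nra.
  by apply/funext => x; rewrite dotZr mulrDr.
- suff -> : (fun x => t * (f1 \max f2) x) =
            (fun x => t * f1 x) \max (fun x => t * f2 x) by exact: plu_max.
  by apply/funext => x /=; rewrite maxr_pMr.
- suff -> : (fun x => t * (f1 \min f2) x) =
            (fun x => t * f1 x) \min (fun x => t * f2 x) by exact: plu_min.
  by apply/funext => x /=; rewrite minr_pMr.
Qed.

(** There are finitely many affine pieces, so a small multiple has slope above -1. For a maximum or
    minimum the smaller of the two constants works, because a factor in [[0, 1]] preserves the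
    bound. *)
Lemma pl_small f u : pl f -> exists2 e, 0 < e & plu u (fun x => e * f x).
Proof.
have frac d e : 0 < e :> R -> 0 < d -> d <= e -> 0 <= d / e <= 1.
  move=> e0 d0 de; rewrite ler_pdivrMr // mul1r de andbT.
  by rewrite divr_ge0 // ltW.
elim=> [a c|f1 f2 _ [e1 e10 p1] _ [e2 e20 p2]|f1 f2 _ [e1 e10 p1] _ [e2 e20 p2]].
- have d0 : 0 < 1 + `|dot u a| by rewrite ltr_pwDl.
  exists (1 + `|dot u a|)^-1; first by rewrite invr_gt0.
  suff -> : (fun x => (1 + `|dot u a|)^-1 * (dot x a + c)) =
     (fun x => dot x ((1 + `|dot u a|)^-1 *: a) + (1 + `|dot u a|)^-1 * c).
    apply: plu_affine; rewrite dotZr mulrC ltr_pdivlMr //.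
    by have := ler_norm (- dot u a); rewrite normrN; lra.
  by apply/funext => x; rewrite dotZr mulrDr.
- have m0 : 0 < Num.min e1 e2 by rewrite lt_min e10.
  exists (Num.min e1 e2) => //.
  suff -> : (fun x => Num.min e1 e2 * (f1 \max f2) x) =
     (fun x => (Num.min e1 e2 / e1) * (e1 * f1 x)) \max
     (fun x => (Num.min e1 e2 / e2) * (e2 * f2 x)).
    by apply: plu_max; apply: plu_scale => //;
      apply: frac; rewrite // ge_min lexx ?orbT.
  by apply/funext => x /=; rewrite !mulrA !divfK ?gt_eqF // maxr_pMr // ltW.
- have m0 : 0 < Num.min e1 e2 by rewrite lt_min e10.
  exists (Num.min e1 e2) => //.
  suff -> : (fun x => Num.min e1 e2 * (f1 \min f2) x) =
     (fun x => (Num.min e1 e2 / e1) * (e1 * f1 x)) \min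
     (fun x => (Num.min e1 e2 / e2) * (e2 * f2 x)).
    by apply: plu_min; apply: plu_scale => //;
      apply: frac; rewrite // ge_min lexx ?orbT.
  by apply/funext => x /=; rewrite !mulrA !divfK ?gt_eqF // minr_pMr // ltW.
Qed.

(** The preimage of [y] under the push is [y - s *: u] where [s = f (y - s *: u)]. Monotonicity
    makes this root unique. *)
Lemma plu_increasing u f y s t : plu u f -> s < t ->
  s - f (y - s *: u) < t - f (y - t *: u).
Proof.
move=> + st; elim=> [a c ua|f1 f2 _ l1 _ l2|f1 f2 _ l1 _ l2].
- by rewrite !dotBl !dotZl; nra.
- rewrite /=; case: (leP (f1 (y - s *: u))); case: (leP (f1 (y - t *: u))); lra.
- rewrite /=; case: (leP (f1 (y - s *: u))); case: (leP (f1 (y - t *: u))); lra.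
Qed.

Lemma plu_inj u f y s t : plu u f -> s = f (y - s *: u) -> t = f (y - t *: u) ->
  s = t.
Proof.
move=> p es et; have [st|ts|//] := ltgtP s t.
- by have := plu_increasing y p st; lra.
- by have := plu_increasing y p ts; lra.
Qed.

(** For an affine [f] the equation is linear with leading coefficient [1 + dot u a > 0]. The root
    for a maximum is the maximum of the roots: beyond its own root each function stays below [s], so
    the larger root decides. Minima are dual. *)
Lemma plu_inverse u f : plu u f -> exists2 psi, plu (- u) psi &
  forall y, psi y = f (y - psi y *: u).
Proof.
elim=> [a c ua|f1 f2 p1 [psi1 q1 e1] p2 [psi2 q2 e2]
              |f1 f2 p1 [psi1 q1 e1] p2 [psi2 q2 e2]].
- have d0 : 0 < 1 + dot u a by lra.
  exists (fun y => dot y ((1 + dot u a)^-1 *: a) + (1 + dot u a)^-1 * c).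
    apply: plu_affine; rewrite dotZr dotNl mulrC ltr_pdivlMr //; lra.
  by move=> y; rewrite dotBl dotZl dotZr; field; rewrite gt_eqF.
- exists (psi1 \max psi2); first exact: plu_max.
  have L k psi y : plu u k -> psi = k (y - psi *: u) ->
      forall s, psi <= s -> k (y - s *: u) <= s.
    move=> p e s; rewrite le_eqVlt => /orP[/eqP <-|ls]; first by rewrite -e.
    by have := plu_increasing y p ls; lra.
  move=> y /=; have := L _ _ _ p1 (e1 y); have := L _ _ _ p2 (e2 y).
  have := e1 y; have := e2 y.
  case: (leP (psi1 y) (psi2 y)) => c E2 E1 /(_ (Num.max (psi1 y) (psi2 y))).
    rewrite (max_idPr c) => /(_ (lexx _)) _ /(_ _ c) h.
    by rewrite -E2 (max_idPr h).
  rewrite (max_idPl (ltW c)) => /(_ (ltW c)) h _.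
  by rewrite -E1 (max_idPl h).
- exists (psi1 \min psi2); first exact: plu_min.
  have L k psi y : plu u k -> psi = k (y - psi *: u) ->
      forall s, s <= psi -> s <= k (y - s *: u).
    move=> p e s; rewrite le_eqVlt => /orP[/eqP ->|ls]; first by rewrite -e.
    by have := plu_increasing y p ls; lra.
  move=> y /=; have := L _ _ _ p1 (e1 y); have := L _ _ _ p2 (e2 y).
  have := e1 y; have := e2 y.
  case: (leP (psi1 y) (psi2 y)) => c E2 E1 /(_ (Num.min (psi1 y) (psi2 y))).
    rewrite (min_idPl c) => /(_ c) h _.
    by rewrite -E1 (min_idPl h).
  rewrite (min_idPr (ltW c)) => /(_ (lexx _)) _ /(_ _ (ltW c)) h.
  by rewrite -E2 (min_idPr h).
Qed.

Definition push u f x : R3 := x + f x *: u.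

Lemma push_continuous u f : continuous f -> continuous (push u f).
Proof.
move=> cf x; apply: (@continuousD R R3 R3 id (fun y => f y *: u) x).
  exact: cvg_id.
apply: (@continuousZr_tmp R R3 R3 f u x).
exact: cf.
Qed.

Lemma plu_push_inverse u f : plu u f -> exists2 psi, plu (- u) psi &
  cancel (push u f) (push (- u) psi) /\ cancel (push (- u) psi) (push u f).
Proof.
move=> p; have [psi q e] := plu_inverse p; exists psi => //.
split=> x; rewrite /push.
  have -> : psi (x + f x *: u) = f x.
    by apply: (plu_inj p (e _)); rewrite addrK.
  by rewrite scalerN addrK.
by rewrite scalerN -e subrK.
Qed.

Lemma plu_push_homeo u f : plu u f -> homeomorphism (push u f).
Proof.
move=> p; have [psi q [k1 k2]] := plu_push_inverse p; split.
  exact/push_continuous/pl_continuous/plu_pl/p.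
exists (push (- u) psi) => //.
exact/push_continuous/pl_continuous/plu_pl/q.
Qed.

Lemma plu_push_isotopic u f : plu u f -> isotopic_to_id (push u f).
Proof.
move=> p; apply: isotopic_to_id_push; first exact/pl_continuous/plu_pl/p.
by move=> t t01; apply: plu_push_homeo (plu_scale t01 p).
Qed.

(** Restricting to finite compositions of pushes gives isotopy to the identity, inverses of the same
    kind and polygonal images of polygonal sets by plain induction. *)
Inductive plhomeo : (R3 -> R3) -> Prop :=
| plhomeo_id : plhomeo id
| plhomeo_push u f h : plu u f -> plhomeo h -> plhomeo (push u f \o h).

Lemma plhomeo_of_push u f : plu u f -> plhomeo (push u f).
Proof. by move=> p; exact: (plhomeo_push p plhomeo_id). Qed.

Lemma plhomeo_comp h g : plhomeo h -> plhomeo g -> plhomeo (h \o g).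
Proof.
elim=> [//|u f {}h p hh IH hg].
exact: (plhomeo_push p (IH hg)).
Qed.

Lemma plhomeo_inverse h : plhomeo h ->
  exists2 g, plhomeo g & cancel h g /\ cancel g h.
Proof.
elim=> [|u f {}h p hh [g gg [hK gK]]]; first by exists id => //; exact: plhomeo_id.
have [psi q [k1 k2]] := plu_push_inverse p.
exists (g \o push (- u) psi); first exact: plhomeo_comp gg (plhomeo_of_push q).
by split => x /=; rewrite ?k1 ?gK ?hK ?k2.
Qed.

Lemma plhomeo_isotopic h : plhomeo h -> isotopic_to_id h.
Proof.
elim=> [|u f {}h p hh IH]; first exact: isotopic_to_id_id.
exact: isotopic_to_id_comp (plu_push_isotopic p) IH.
Qed.

Lemma plhomeo_continuous h : plhomeo h -> continuous h.
Proof. by move=> /plhomeo_isotopic/isotopic_to_id_homeo []. Qed.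

Lemma plhomeo_inj h : plhomeo h -> injective h.
Proof. by move=> /plhomeo_inverse[g _ [hK _]]; exact: can_inj hK. Qed.

End PiecewiseLinear.

(** * Polygonal sets *)

Lemma bigcup_nil (I : choiceType) (T : Type) (F : I -> set T) :
  \bigcup_(i in [set` [::]]) F i = set0.
Proof. by apply/seteqP; split=> // x []. Qed.

Lemma bigcup_cons (I : choiceType) (T : Type) (i : I) (l : seq I)
    (F : I -> set T) :
  \bigcup_(j in [set` i :: l]) F j = F i `|` \bigcup_(j in [set` l]) F j.
Proof.
apply/seteqP; split=> x.
  move=> [q /=]; rewrite inE => /orP[/eqP ->|ql] xq; first by left.
  by right; exists q.
case=> [xp|[q /= ql xq]]; first by exists i; rewrite //= mem_head.
by exists q; rewrite //= inE ql orbT.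
Qed.

Section Polygonal.
Variable R : realType.
Local Notation R3 := 'rV[R]_3.
Implicit Types (h g : R3 -> R3) (f : R3 -> R) (A B K Z : set R3).
Implicit Types (x y u a b c d : R3) (s t : R).

Lemma segment_pointE a b t : (1 - t) *: a + t *: b = a + t *: (b - a).
Proof. by rewrite scalerBl scale1r scalerBr -addrA [- _ + _]addrC. Qed.

Lemma segmentP a b x :
  segment a b x <-> exists2 t, 0 <= t <= 1 & x = a + t *: (b - a).
Proof.
split=> [[t /=]|[t t01 ->]]; rewrite ?in_itv /=.
  by move=> t01 <-; exists t => //; rewrite segment_pointE.
by exists t; rewrite /= ?in_itv //= segment_pointE.
Qed.

Lemma segment_sym a b : segment a b = segment b a.
Proof.
suff H c d : segment c d `<=` segment d c by apply/seteqP; split; exact: H.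
move=> x [t]; rewrite /= in_itv /= => t01 <-; exists (1 - t).
  by rewrite /= in_itv /=; lra.
by rewrite opprB addrCA subrr addr0 addrC.
Qed.

Lemma segment_left a b : segment a b a.
Proof. by apply/segmentP; exists 0; rewrite ?lexx ?ler01 // scale0r addr0. Qed.

Lemma segment_right a b : segment a b b.
Proof. by rewrite segment_sym; exact: segment_left. Qed.

Lemma segment_convex a b p q :
  segment a b p -> segment a b q -> segment p q `<=` segment a b.
Proof.
move=> /segmentP[s s01 ->] /segmentP[t t01 ->] x /segmentP[r r01 ->].
apply/segmentP; exists ((1 - r) * s + r * t); first by nra.
rewrite opprD addrACA subrr add0r -scalerBl scalerA -addrA -scalerDl.
by congr (_ + _ *: _); ring.
Qed.

Lemma segment_cat a b c : segment a b c ->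
  segment a b = segment a c `|` segment c b.
Proof.
move=> abc; apply/seteqP; split=> x; last first.
  case; apply: segment_convex => //;
    [exact: segment_left|exact: segment_right].
move: abc => /segmentP[t t01 ->] /segmentP[s s01 ->].
have [st|ts] := leP s t.
  left; apply/segmentP; have [t0|t0] := eqVneq t 0.
    by exists 0; rewrite ?lexx ?ler01 // (_ : s = 0) ?scale0r //; lra.
  exists (s / t); last first.
    by rewrite [a + t *: _]addrC addrK scalerA divfK.
  have t_gt0 : 0 < t by rewrite lt_neqAle eq_sym t0; lra.
  by rewrite ler_pdivrMr // ler_pdivlMr //; lra.
right; apply/segmentP; exists ((s - t) / (1 - t)).
  by rewrite ler_pdivrMr ?ler_pdivlMr; lra.
have -> : b - (a + t *: (b - a)) = (1 - t) *: (b - a).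
  by rewrite scalerBl scale1r opprD addrA.
rewrite scalerA divfK ?gt_eqF ?subr_gt0 //; last lra.
by rewrite -addrA -scalerDl addrCA subrr addr0.
Qed.

Definition polyline (l : seq (R3 * R3)) : set R3 :=
  \bigcup_(p in [set` l]) segment p.1 p.2.

Lemma polyline_nil : polyline [::] = set0.
Proof. exact: bigcup_nil. Qed.

Lemma polyline_cons p l : polyline (p :: l) = segment p.1 p.2 `|` polyline l.
Proof. exact: bigcup_cons. Qed.

Lemma polyline_cat l l' : polyline (l ++ l') = polyline l `|` polyline l'.
Proof.
elim: l => [|p l IH]; first by rewrite polyline_nil set0U.
by rewrite cat_cons !polyline_cons IH setUA.
Qed.

Lemma polygonalU A B : polygonal A -> polygonal B -> polygonal (A `|` B).
Proof. by move=> [l ->] [l' ->]; exists (l ++ l'); rewrite -polyline_cat. Qed.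

Lemma polygonal0 : polygonal (@set0 R3).
Proof. by exists [::]; rewrite -[RHS]/(polyline _) polyline_nil. Qed.

Lemma polygonal_segment a b : polygonal (segment a b).
Proof.
by exists [:: (a, b)]; rewrite -[RHS]/(polyline _) polyline_cons polyline_nil setU0.
Qed.

Lemma polygonal1 a : polygonal [set a].
Proof.
suff <- : segment a a = [set a] by exact: polygonal_segment.
apply/seteqP; split=> [x /segmentP[t _ ->]|x /= ->].
  by rewrite subrr scaler0 addr0.
exact: segment_left.
Qed.

Lemma polygonal_bigcup (I : choiceType) (l : seq I) (F : I -> set R3) :
  (forall i, i \in l -> polygonal (F i)) ->
  polygonal (\bigcup_(i in [set` l]) F i).
Proof.
elim: l => [|i l IH] pF.
  by rewrite bigcup_nil; exact: polygonal0.
rewrite bigcup_cons; apply: polygonalU.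
  by apply: pF; rewrite mem_head.
by apply: IH => j jl; apply: pF; rewrite inE jl orbT.
Qed.

(** The pieces may overlap and come in any order; this suffices for computing images of sets. *)
Definition subdivided (P : R3 -> R3 -> Prop) A :=
  exists2 l, A = polyline l & forall p, p \in l -> P p.1 p.2.

(** The inclusion in [A] is passed to the second subdivision so that what is already known on [A],
    such as affinity of another function, restricts to the new pieces. *)
Lemma subdivided_refine (P Q : R3 -> R3 -> Prop) A : subdivided P A ->
  (forall a b, segment a b `<=` A -> P a b -> subdivided Q (segment a b)) ->
  subdivided Q A.
Proof.
move=> [l ->] {A}; elim: l => [|p l IH] Pl PQ.
  by exists [::].
have [||l1 e1 Q1] := PQ p.1 p.2.
- by rewrite polyline_cons; exact: subsetUl.
- by apply: Pl; rewrite mem_head.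
have [||l2 e2 Q2] := IH.
- by move=> q ql; apply: Pl; rewrite inE ql orbT.
- move=> a b ab; apply: PQ; rewrite polyline_cons.
  exact: subset_trans ab (@subsetUr _ _ _).
exists (l1 ++ l2); first by rewrite polyline_cons e1 e2 polyline_cat.
by move=> q; rewrite mem_cat => /orP[/Q1|/Q2].
Qed.

Lemma subdivided1 (P : R3 -> R3 -> Prop) a b : P a b -> subdivided P (segment a b).
Proof.
move=> Pab; exists [:: (a, b)]; first by rewrite polyline_cons polyline_nil setU0.
by move=> p; rewrite inE => /eqP ->.
Qed.

Definition affine_on f a b :=
  forall t, 0 <= t <= 1 -> f (a + t *: (b - a)) = f a + t * (f b - f a).

Lemma affine_on_sub f a b p q : segment a b p -> segment a b q ->
  affine_on f a b -> affine_on f p q.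
Proof.
move=> /segmentP[s s01 ->] /segmentP[t t01 ->] fab r r01.
rewrite {1}opprD addrACA subrr add0r -scalerBl scalerA -addrA -scalerDl.
by rewrite !fab //; [ring|nra].
Qed.

Lemma affine_on_maxmin f1 f2 a b : affine_on f1 a b -> affine_on f2 a b ->
  f1 a <= f2 a -> f1 b <= f2 b ->
  [/\ affine_on (f1 \max f2) a b, affine_on (f1 \min f2) a b,
      affine_on (f2 \max f1) a b & affine_on (f2 \min f1) a b].
Proof.
move=> h1 h2 la lb.
have l t : 0 <= t <= 1 -> f1 (a + t *: (b - a)) <= f2 (a + t *: (b - a)).
  by move=> t01; rewrite h1 // h2 //; nra.
split=> t t01 /=; rewrite ?(max_idPr la) ?(max_idPr lb) ?(min_idPl la)
  ?(min_idPl lb) ?(max_idPl la) ?(max_idPl lb) ?(min_idPr la) ?(min_idPr lb);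
  have := l t t01 => lt; rewrite ?(max_idPr lt) ?(min_idPl lt) ?(max_idPl lt)
  ?(min_idPr lt); by [exact: h1|exact: h2].
Qed.

(** If the order of the two functions is the same at both ends it is the same throughout; otherwise
    they cross once and the segment is cut at the crossing. *)
Lemma affine_on_split f1 f2 a b : affine_on f1 a b -> affine_on f2 a b ->
  subdivided (fun p q => affine_on (f1 \max f2) p q /\ affine_on (f1 \min f2) p q)
    (segment a b).
Proof.
move=> h1 h2.
have [la|la] := leP (f1 a) (f2 a); have [lb|lb] := leP (f1 b) (f2 b).
- by apply: subdivided1; have [] := affine_on_maxmin h1 h2 la lb.
(* The parameter at which the affine function [f1 - f2] changes sign. *)
- pose r := (f2 a - f1 a) / (f2 a - f1 a + (f1 b - f2 b)).
  have d0 : 0 < f2 a - f1 a + (f1 b - f2 b) by lra.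
  have r01 : 0 <= r <= 1 by rewrite /r ler_pdivrMr ?ler_pdivlMr; lra.
  have rE : r * (f2 a - f1 a + (f1 b - f2 b)) = f2 a - f1 a.
    by rewrite /r divfK ?gt_eqF.
  pose c := a + r *: (b - a).
  have abc : segment a b c by apply/segmentP; exists r.
  have ec : f1 c = f2 c by rewrite /c h1 // h2 //; lra.
  have [g1 g2] : affine_on f1 a c /\ affine_on f2 a c.
    by split; apply: affine_on_sub (segment_left a b) abc _.
  have [k1 k2] : affine_on f1 c b /\ affine_on f2 c b.
    by split; apply: affine_on_sub abc (segment_right a b) _.
  exists [:: (a, c); (c, b)].
    by rewrite !polyline_cons polyline_nil setU0 -segment_cat.
  move=> p; rewrite !inE => /orP[] /eqP -> /=.
    by have [||] := affine_on_maxmin g1 g2 => //; rewrite ec.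
  by have [||] := affine_on_maxmin k2 k1 => //; [rewrite ec|exact: ltW].
- pose r := (f1 a - f2 a) / (f1 a - f2 a + (f2 b - f1 b)).
  have d0 : 0 < f1 a - f2 a + (f2 b - f1 b) by lra.
  have r01 : 0 <= r <= 1 by rewrite /r ler_pdivrMr ?ler_pdivlMr; lra.
  have rE : r * (f1 a - f2 a + (f2 b - f1 b)) = f1 a - f2 a.
    by rewrite /r divfK ?gt_eqF.
  pose c := a + r *: (b - a).
  have abc : segment a b c by apply/segmentP; exists r.
  have ec : f1 c = f2 c by rewrite /c h1 // h2 //; lra.
  have [g1 g2] : affine_on f1 a c /\ affine_on f2 a c.
    by split; apply: affine_on_sub (segment_left a b) abc _.
  have [k1 k2] : affine_on f1 c b /\ affine_on f2 c b.
    by split; apply: affine_on_sub abc (segment_right a b) _.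
  exists [:: (a, c); (c, b)].
    by rewrite !polyline_cons polyline_nil setU0 -segment_cat.
  move=> p; rewrite !inE => /orP[] /eqP -> /=.
    by have [||] := affine_on_maxmin g2 g1 => //; [exact: ltW|rewrite ec].
  by have [||] := affine_on_maxmin k1 k2 => //; rewrite ec.
- by apply: subdivided1; have [] := affine_on_maxmin h2 h1 (ltW la) (ltW lb).
Qed.

Lemma pl_subdivided f a b : pl f -> subdivided (affine_on f) (segment a b).
Proof.
move=> pf; elim: pf a b => [v k|f1 f2 _ IH1 _ IH2|f1 f2 _ IH1 _ IH2] a b.
- apply: subdivided1 => t _.
  by rewrite !dotDl dotZl dotBl; ring.
- apply: subdivided_refine (IH1 a b) _ => c d _ f1cd.
  apply: subdivided_refine (IH2 c d) _ => p q pqcd f2pq.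
  have f1pq : affine_on f1 p q.
    by apply: affine_on_sub f1cd; apply: pqcd;
      [exact: segment_left|exact: segment_right].
  have [l e Hl] := affine_on_split f1pq f2pq.
  by exists l => // r /Hl[].
- apply: subdivided_refine (IH1 a b) _ => c d _ f1cd.
  apply: subdivided_refine (IH2 c d) _ => p q pqcd f2pq.
  have f1pq : affine_on f1 p q.
    by apply: affine_on_sub f1cd; apply: pqcd;
      [exact: segment_left|exact: segment_right].
  have [l e Hl] := affine_on_split f1pq f2pq.
  by exists l => // r /Hl[].
Qed.

Lemma push_segment u f a b : affine_on f a b ->
  push u f @` segment a b = segment (push u f a) (push u f b).
Proof.
move=> fab.
have E t : 0 <= t <= 1 -> push u f (a + t *: (b - a)) =
    push u f a + t *: (push u f b - push u f a).
  by move=> t01; rewrite /push fab //; apply/rowP => i; rewrite !mxE; ring.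
apply/seteqP; split=> [_ [x /segmentP[t t01 ->] <-]|x /segmentP[t t01 ->]].
  by apply/segmentP; exists t => //; exact: E.
by exists (a + t *: (b - a)); [apply/segmentP; exists t|exact: E].
Qed.

Lemma polygonal_push u f A : pl f -> polygonal A -> polygonal (push u f @` A).
Proof.
move=> pf [l ->]; rewrite image_bigcup.
apply: polygonal_bigcup => p _.
have [l' -> Hl'] := pl_subdivided p.1 p.2 pf.
rewrite image_bigcup; apply: polygonal_bigcup => q /Hl' fq.
by rewrite push_segment //; exact: polygonal_segment.
Qed.

Lemma polygonal_plhomeo h A : plhomeo h -> polygonal A -> polygonal (h @` A).
Proof.
move=> hh; elim: hh A => [|u f {}h pf hh IH] A pA; first by rewrite image_id.
rewrite -image_comp; exact: polygonal_push (plu_pl pf) (IH _ pA).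
Qed.

(** Such a [rho] plays the role of a distance to [Z]: pushing by a small multiple of it along a
    nonzero vector fixes [Z] and moves every other point. *)
Definition pl_closed Z := exists rho, [/\ pl rho, forall x, 0 <= rho x &
  forall x, rho x = 0 <-> Z x].

Lemma pl_closed0 : pl_closed set0.
Proof.
exists (cst 1); split=> //; first exact: pl_cst.
by move=> x; split=> // /eqP; rewrite oner_eq0.
Qed.

Lemma pl_closedT : pl_closed setT.
Proof. by exists (cst 0); split=> //; exact: pl_cst. Qed.

Lemma pl_closedI A B : pl_closed A -> pl_closed B -> pl_closed (A `&` B).
Proof.
move=> [r1 [p1 n1 z1]] [r2 [p2 n2 z2]]; exists (r1 \max r2); split.
- exact: pl_max.
- by move=> x /=; rewrite le_max n1.
move=> x /=; split=> [h|[/z1 -> /z2 ->]]; last by rewrite maxxx.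
split; [apply/z1|apply/z2]; apply/eqP; rewrite eq_le ?n1 ?n2 andbT -h le_max lexx //.
by rewrite orbT.
Qed.

Lemma pl_closedU A B : pl_closed A -> pl_closed B -> pl_closed (A `|` B).
Proof.
move=> [r1 [p1 n1 z1]] [r2 [p2 n2 z2]]; exists (r1 \min r2); split.
- exact: pl_min.
- by move=> x /=; rewrite le_min n1 n2.
move=> x /=; split.
  by case: (leP (r1 x) (r2 x)) => _ => [/z1|/z2]; [left|right].
case=> [/z1 ->|/z2 ->]; first exact/min_idPl.
exact/min_idPr.
Qed.

Lemma pl_closed_halfspace a k : pl_closed [set x | dot x a + k <= 0].
Proof.
exists ((fun x => dot x a + k) \max cst 0); split.
- by apply: pl_max; [exact: pl_affine|exact: pl_cst].
- by move=> x /=; rewrite le_max lexx orbT.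
by move=> x /=; split=> [h|/max_idPr //]; rewrite -h le_max lexx.
Qed.

Lemma pl_closed_forall (I : finType) (F : I -> set R3) :
  (forall i, pl_closed (F i)) -> pl_closed [set x | forall i, F i x].
Proof.
move=> pF.
suff H : forall l : seq I, pl_closed [set x | forall i, i \in l -> F i x].
  have [r [p n z]] := H (enum I); exists r; split=> // x; rewrite z /=.
  by split=> Hx i; [apply: Hx; rewrite mem_enum|].
elim=> [|i l IH].
  rewrite (_ : [set _ | _] = setT); first exact: pl_closedT.
  by apply/seteqP; split.
rewrite (_ : [set _ | _] = F i `&` [set x | forall i, i \in l -> F i x]).
  exact: pl_closedI.
apply/seteqP; split=> x /=.
  move=> H; split; first by apply: H; rewrite mem_head.
  by move=> j jl; apply: H; rewrite inE jl orbT.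
by move=> [Fi Fl] j; rewrite inE => /orP[/eqP ->|/Fl].
Qed.

(* The bounding box is what pins down the degenerate segments. *)
Lemma segmentE p q : segment p q =
  [set x : R3 | forall ij : 'I_3 * 'I_3, (x - p) ord0 ij.1 * (q - p) ord0 ij.2 -
      (x - p) ord0 ij.2 * (q - p) ord0 ij.1 <= 0] `&`
  ([set x : R3 | forall i, x ord0 i - Num.max (p ord0 i) (q ord0 i) <= 0] `&`
   [set x : R3 | forall i, - x ord0 i + Num.min (p ord0 i) (q ord0 i) <= 0]).
Proof.
apply/seteqP; split=> x.
  move=> /segmentP[t t01 ->]; split; [|split] => /=.
  - move=> [i j] /=; rewrite addrAC subrr add0r !mxE.
    by rewrite le_eqVlt; apply/orP; left; apply/eqP; ring.
  - by move=> i; rewrite !mxE; case: (leP (p ord0 i) (q ord0 i)) => h; nra.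
  - by move=> i; rewrite !mxE; case: (leP (p ord0 i) (q ord0 i)) => h; nra.
move=> [/= cr [mx mn]]; apply/segmentP.
have [pq|pq] := eqVneq q p.
  exists 0; first by rewrite lexx ler01.
  rewrite scale0r addr0; apply/rowP => i.
  by move: (mx i) (mn i); rewrite pq maxxx minxx; lra.
have [k dk] : exists k, q ord0 k - p ord0 k != 0.
  apply/existsP; apply: contra_neqT pq; rewrite negb_exists => /forallP pq.
  by apply/rowP => i; have := pq i; rewrite negbK subr_eq0 => /eqP.
exists ((x ord0 k - p ord0 k) / (q ord0 k - p ord0 k)).
  move: (mx k) (mn k); case: (leP (p ord0 k) (q ord0 k)) => h mk nk.
    have d0 : 0 < q ord0 k - p ord0 k by rewrite lt_neqAle eq_sym dk; lra.
    by rewrite ler_pdivrMr ?ler_pdivlMr //; lra.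
  rewrite -mulrNN -invrN !opprB.
  by rewrite ler_pdivrMr ?ler_pdivlMr //; lra.
(* The inequalities for [(k, i)] and [(i, k)] have opposite left-hand sides, so together they say
   that this coordinate of the cross product vanishes. *)
apply/rowP => i; move: (cr (k, i)) (cr (i, k)); rewrite !mxE /= => c1 c2.
suff -> : x ord0 i = p ord0 i + (x ord0 k - p ord0 k) * (q ord0 i - p ord0 i) /
    (q ord0 k - p ord0 k) by rewrite mulrAC.
have -> : (x ord0 k - p ord0 k) * (q ord0 i - p ord0 i) =
  (x ord0 i - p ord0 i) * (q ord0 k - p ord0 k) by lra.
by rewrite mulfK //; lra.
Qed.

Lemma pl_closed_segment p q : pl_closed (segment p q).
Proof.
have hs (F : R3 -> R) a k : (forall x, F x = dot x a + k) ->
    pl_closed [set x | F x <= 0].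
  move=> e; suff -> : [set x | F x <= 0] = [set x | dot x a + k <= 0].
    exact: pl_closed_halfspace.
  by apply/seteqP; split=> x /=; rewrite e.
rewrite segmentE; apply: pl_closedI; [|apply: pl_closedI];
  apply: pl_closed_forall => i.
- case: i => i j; pose v : R3 := (q - p) ord0 j *: delta_mx ord0 i -
    (q - p) ord0 i *: delta_mx ord0 j.
  apply: (hs _ v (- dot p v)) => x.
  rewrite -dotBl dotBr !dotZr !dot_delta; ring.
- by apply: (hs _ (delta_mx ord0 i)) => x; rewrite dot_delta.
- apply: (hs _ (- delta_mx ord0 i)) => x.
  by rewrite dotC dotNl dotC dot_delta.
Qed.

Lemma polygonal_pl_closed Z : polygonal Z -> pl_closed Z.
Proof.
move=> [l ->]; rewrite -/(polyline l); elim: l => [|p l IH].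
  by rewrite polyline_nil; exact: pl_closed0.
by rewrite polyline_cons; apply: pl_closedU IH; exact: pl_closed_segment.
Qed.

End Polygonal.

(** * Straightening polygonal arcs *)

(** Supplies a value skipped by a function of finite range, against the intermediate value theorem,
    and later a generic scalar. *)
Lemma finite_avoid (R : realType) (l : seq R) (a b : R) : a < b ->
  exists2 c, a < c < b & c \notin l.
Proof.
move=> ab; suff [c [d [ac cd db H]]] : exists c d, [/\ a <= c, c < d, d <= b &
    forall x, x \in l -> ~~ (c < x < d)].
  exists ((c + d) / 2); first lra.
  by apply/negP => /H; rewrite midf_lt // andbC midf_lt.
elim: l => [|x l [c [d [ac cd db H]]]]; first by exists a, b; split.
have [/andP[cx xd]|xcd] := boolP (c < x < d).
  exists c, x; split=> //; first lra.
  move=> y; rewrite inE => /orP[/eqP ->|/H]; first by rewrite ltxx andbF.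
  by apply: contra => /andP[-> yx]; rewrite (lt_trans yx).
exists c, d; split=> // y; rewrite inE => /orP[/eqP -> //|]; exact: H.
Qed.

Section Arcs.
Variable R : realType.
Local Notation R3 := 'rV[R]_3.
Implicit Types (h g : R3 -> R3) (f : R3 -> R) (A B K Z : set R3).
Implicit Types (x y u a b c d : R3) (s t : R) (gam : R -> R3).

(** Only the image is polygonal; the parametrization is not assumed piecewise linear, and
    injectivity is asked on [[0, 1]] alone. *)
Definition pl_arc gam := [/\ continuous gam,
  forall s t, 0 <= s <= 1 -> 0 <= t <= 1 -> gam s = gam t -> s = t
  & polygonal (gam @` `[0, 1])].

(* The direction of a polygonal path as seen from one of its points takes
   finitely many values near that point, hence it is locally constant. *)
Lemma arc_direction gam t : pl_arc gam -> 0 <= t < 1 -> exists d t',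
  [/\ t < t', t' <= 1 & forall s, t <= s <= t' ->
      gam s = gam t + `|gam s - gam t| *: d].
Proof.
move=> [cg ig [l el]] t01; set p := gam t.
(* [C] collects the segments that miss [p]. Being closed, it is also missed by the path for
   parameters near [t], so nearby points lie on segments through [p]. *)
pose C := polyline [seq w <- l | ~~ `[< segment w.1 w.2 p >]].
have nCp : ~ C p.
  by move=> [w /=]; rewrite mem_filter => /andP[/asboolPn].
have [rho [prho rho0 rhoC]] : pl_closed C by apply: polygonal_pl_closed; eexists.
have rhop : 0 < rho p by rewrite lt_neqAle rho0 eq_sym andbT; apply/eqP => /rhoC.
have crho : {for t, continuous (rho \o gam)}.
  by apply: continuous_comp; [exact: cg|exact: pl_continuous].
have /nbhs_ballP[e /= e0 He] : \forall s \near t, 0 < rho (gam s).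
  exact: (cvgr_gt _ crho).
pose t' := Num.min 1 (t + e / 2).
have tt' : t < t' by rewrite lt_min; apply/andP; split; lra.
have t'1 : t' <= 1 by rewrite ge_min lexx.
have t'e : t' <= t + e / 2 by rewrite ge_min lexx orbT.
pose theta s := `|gam s - p|^-1 *: (gam s - p).
have neqp s : t < s <= t' -> gam s - p != 0.
  move=> ts; rewrite subr_eq0; apply/eqP => /ig; lra.
(* On a segment through [p] the normalised direction from [p] is that of the segment up to sign,
   whence two candidates for each segment. *)
pose D : seq R3 := [seq `|w.2 - w.1|^-1 *: (w.2 - w.1) | w <- l] ++
   [seq - (`|w.2 - w.1|^-1 *: (w.2 - w.1)) | w <- l].
have thetaD s : t < s <= t' -> theta s \in D.
  move=> ts; have : (gam @` `[0, 1]) (gam s).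
    by exists s => //=; rewrite in_itv /=; lra.
  rewrite el => -[w /= wl sw].
  have /segmentP[r1 _ e1] : segment w.1 w.2 p.
    apply: contrapT => np; have : 0 < rho (gam s).
      by apply: He; rewrite /ball /= ltr_distlC; lra.
    rewrite (_ : rho _ = 0) ?ltxx //; apply/rhoC; exists w => //=.
    by rewrite mem_filter wl andbT; apply/asboolPn.
  move: sw => /segmentP[r2 _ e2].
  have E : gam s - p = (r2 - r1) *: (w.2 - w.1).
    by rewrite e1 e2 opprD addrACA subrr add0r scalerBl.
  have n0 := neqp _ ts.
  have r0 : r2 - r1 != 0 by apply: contraNneq n0 => r0; rewrite E r0 scale0r.
  have -> : theta s = ((r2 - r1) / `|r2 - r1|) *:
      (`|w.2 - w.1|^-1 *: (w.2 - w.1)).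
    by rewrite /theta E normrZ invfM !scalerA; congr (_ *: _); ring.
  rewrite mem_cat; apply/orP.
  have [r_gt0|r_le0] := ltP 0 (r2 - r1).
    by left; rewrite gtr0_norm // divff // scale1r; apply: map_f wl.
  right; rewrite ler0_norm // invrN mulrN divff // scaleN1r.
  exact: (map_f (fun w : R3 * R3 => - (`|w.2 - w.1|^-1 *: (w.2 - w.1))) wl).
have ctheta s i : t < s <= t' -> {for s, continuous (fun r => theta r ord0 i)}.
  move=> ts.
  have cgp : {for s, continuous (fun r => gam r - p)}.
    by apply: continuousB; [exact: cg|exact: cst_continuous].
  have cn : {for s, continuous (fun r => `|gam r - p|^-1)}.
    have n0 : `|gam s - p| != 0 by rewrite normr_eq0 neqp.
    have cnn : {for s, continuous (fun r => `|gam r - p|)} by exact: (cvg_norm cgp).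
    exact: (@continuousV R R _ _ n0 cnn).
  have cc : {for s, continuous (fun r => (gam r - p) ord0 i)}.
    apply: (@continuous_comp R R3 R (fun r => gam r - p) (fun x => x ord0 i)) => //.
    exact: coord_continuous.
  suff -> : (fun r => theta r ord0 i) =
      (fun r => `|gam r - p|^-1) \* (fun r => (gam r - p) ord0 i).
    exact: (@continuousM R R _ _ s cn cc).
  by apply/funext => r /=; rewrite /theta !mxE.
(* A coordinate of [theta] with two values would take one outside the finite list by the
   intermediate value theorem. The parameter [t] is left out since there [theta] is 0, the inverse
   of 0 being 0. *)
have const s1 s2 : t < s1 -> s1 <= s2 -> s2 <= t' -> theta s1 = theta s2.
  move=> ts1 s12 s2t; apply/rowP => i; apply: contrapT => /eqP neq.
  have cw : {within `[s1, s2], continuous (fun r => theta r ord0 i)}.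
    apply: continuous_in_subspaceT => s; rewrite inE /= in_itv /= => hs.
    by apply: ctheta; lra.
  pose m := Num.min (theta s1 ord0 i) (theta s2 ord0 i).
  pose M := Num.max (theta s1 ord0 i) (theta s2 ord0 i).
  have mM : m < M.
    rewrite /m /M; move: neq; rewrite neq_lt => /orP[] h.
      by rewrite (min_idPl (ltW h)) (max_idPr (ltW h)).
    by rewrite (min_idPr (ltW h)) (max_idPl (ltW h)).
  have [c /andP[mc cM] cD] := finite_avoid [seq x ord0 i | x <- D] mM.
  have [|r rs rc] := IVT s12 cw (v := c); first by rewrite (ltW mc) ltW.
  move: cD; rewrite -rc => /negP; apply; apply: (map_f (fun x : R3 => x ord0 i)).
  by apply: thetaD; move: rs; rewrite in_itv /=; lra.
exists (theta t'), t'; split => // s /andP[ts st'].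
move: ts; rewrite le_eqVlt => /orP[/eqP <-|ts].
  by rewrite subrr normr0 scale0r addr0.
rewrite -(const s t') // /theta scalerA divff ?scale1r; first by rewrite addrC subrK.
by rewrite normr_eq0; apply: neqp; lra.
Qed.

(** With a constant direction, the distance [lam] to the starting point determines the point. It is
    continuous and injective, so it sweeps exactly the interval from 0 to [lam s]. *)
Lemma arc_right_straight gam t : pl_arc gam -> 0 <= t < 1 -> exists t',
  [/\ t < t', t' <= 1 & forall s, t < s <= t' ->
      gam @` `[t, s] = segment (gam t) (gam s)].
Proof.
move=> ag t01; have [d [t' [tt' t'1 H]]] := arc_direction ag t01.
have [cg ig _] := ag.
exists t'; split=> // s ts.
pose lam r := `|gam r - gam t|.
have lamt : lam t = 0 by rewrite /lam subrr normr0.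
have clam : continuous lam.
  move=> r; suff cgp : {for r, continuous (fun r => gam r - gam t)}.
    exact: (cvg_norm cgp).
  by apply: continuousB; [exact: cg|exact: cst_continuous].
have lam_inj r1 r2 : t <= r1 <= t' -> t <= r2 <= t' -> lam r1 = lam r2 -> r1 = r2.
  move=> h1 h2 e; apply: ig; [lra|lra|].
  by rewrite (H r1) // (H r2) //; congr (_ + _ *: _).
have ls : 0 < lam s.
  rewrite lt_neqAle normr_ge0 andbT eq_sym; apply/eqP.
  by rewrite -[X in _ = X]lamt => /lam_inj; lra.
have hs : t <= s <= t' by lra.
have ds : gam s - gam t = lam s *: d by rewrite [in LHS]H // addrC addKr.
apply/seteqP; split=> [y [r /=]|x /segmentP[tau tau01 ->]].
  rewrite in_itv /= => tr <-.
  have lr : lam r <= lam s.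
    rewrite leNgt; apply/negP => lt_sr.
    have [|||r' r't e'] := @IVT _ lam t r (lam s).
    - lra.
    - exact: continuous_subspaceT.
    - by rewrite lamt ge_min le_max (ltW lt_sr) orbT (ltW ls).
    move: r't; rewrite in_itv /= => r't.
    have : r' = s by apply: lam_inj => //; lra.
    move=> er'; have er : r = s by lra.
    by move: lt_sr; rewrite er ltxx.
  apply/segmentP; exists (lam r / lam s).
    by rewrite ler_pdivrMr // ler_pdivlMr // mul0r mul1r lr normr_ge0.
  by rewrite ds scalerA divfK ?gt_eqF //; apply: H; lra.
have [|||r rt er] := @IVT _ lam t s (tau * lam s).
- lra.
- exact: continuous_subspaceT.
- rewrite lamt ge_min le_max; apply/andP; split; apply/orP; [left|right]; nra.
move: rt; rewrite in_itv /= => rt; exists r; first by rewrite /= in_itv.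
rewrite H; last lra.
by rewrite -/(lam r) er ds scalerA.
Qed.

Lemma image_reverse (gam : R -> R3) (a b : R) :
  (fun s => gam (1 - s)) @` `[a, b] = gam @` `[1 - b, 1 - a].
Proof.
apply/seteqP; split=> y [r /=]; rewrite in_itv /= => hr <-.
  by exists (1 - r) => //=; rewrite in_itv /=; lra.
by exists (1 - r); rewrite /= ?in_itv /=; [lra|congr gam; lra].
Qed.

Lemma pl_arc_reverse gam : pl_arc gam -> pl_arc (fun s => gam (1 - s)).
Proof.
move=> [cg ig pg]; split.
- move=> t; apply: (@continuous_comp _ _ _ (fun s : R => 1 - s) gam).
    by apply: continuousB; [exact: cst_continuous|exact: cvg_id].
  exact: cg.
- move=> s t hs ht /ig; lra.
- by rewrite image_reverse subr0 subrr.
Qed.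

Lemma arc_left_straight gam t : pl_arc gam -> 0 < t <= 1 -> exists t',
  [/\ 0 <= t', t' < t & forall s, t' <= s < t ->
      gam @` `[s, t] = segment (gam s) (gam t)].
Proof.
move=> /pl_arc_reverse ag t01.
have [|t' [tt' t'1 H]] := arc_right_straight (t := 1 - t) ag; first lra.
exists (1 - t'); split; [lra|lra|] => s st.
have := H (1 - s); rewrite image_reverse !opprB !addrA ![1 + _]addrC !addrK.
by rewrite segment_sym => -> //; lra.
Qed.

Lemma pl_arc_plhomeo g gam : plhomeo g -> pl_arc gam -> pl_arc (g \o gam).
Proof.
move=> hg [cg ig pg]; split.
- by move=> t; apply: continuous_comp; [exact: cg|exact: plhomeo_continuous].
- by move=> s t hs ht /= /(plhomeo_inj hg)/ig; exact.
- by rewrite -image_comp; exact: polygonal_plhomeo.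
Qed.

End Arcs.

(** * Straightening an arc: bending, shrinking and the supremum argument *)

Section Straighten.
Variable R : realType.
Local Notation R3 := 'rV[R]_3.
Implicit Types (h g : R3 -> R3) (f : R3 -> R) (A B K Z : set R3).
Implicit Types (x y u a b c d : R3) (s t : R) (gam : R -> R3).

(** A negative [lam] would fold the second segment back over the first, putting [c] on [segment a b]
    or [a] on [segment b c], against the hypothesis that they meet only in [b]. *)
Lemma collinear_concat a b c (lam : R) : a != b -> b != c ->
  (forall x, segment a b x -> segment b c x -> x = b) ->
  c - b = lam *: (b - a) -> segment a b `|` segment b c = segment a c.
Proof.
move=> ab bc H E.
have cE : c = b + lam *: (b - a) by rewrite -E addrC subrK.
have l0 : lam != 0.
  by apply: contra_neq bc => l0; rewrite cE l0 scale0r addr0.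
have [l_lt0|l_gt0|/eqP] := ltgtP lam 0; last by rewrite (negbTE l0).
  exfalso; have [l1|l1] := leP (- lam) 1.
    have : c = b.
      apply: H; last exact: segment_right.
      apply/segmentP; exists (1 + lam); first lra.
      by rewrite cE; apply/rowP => i; rewrite !mxE; ring.
    by move=> ecb; rewrite ecb eqxx in bc.
  have : a = b.
    apply: H; first exact: segment_left.
    apply/segmentP; exists (- lam^-1).
      by rewrite -invrN invr_ge0 invf_le1; lra.
    by rewrite E scalerA mulNr mulVf // scaleN1r opprB addrC subrK.
  by move=> eab; rewrite eab eqxx in ab.
rewrite -segment_cat //; apply/segmentP; exists (1 + lam)^-1.
  by rewrite invr_ge0 invf_le1; lra.
have -> : c - a = (1 + lam) *: (b - a).
  by rewrite cE; apply/rowP => i; rewrite !mxE; ring.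
by rewrite scalerA mulVf ?scale1r 1?addrC ?subrK // gt_eqF //; lra.
Qed.

(* The half-space beyond b is sheared so that the second segment becomes the
   continuation of the first. *)
Lemma bend a b c : a != b -> b != c ->
  (forall x, segment a b x -> segment b c x -> x = b) ->
  exists k, [/\ plhomeo k, k a = a &
    k @` (segment a b `|` segment b c) = segment a (k c)].
Proof.
move=> ab bc H.
pose v := b - a; pose w := c - b; pose u := v - w.
have v0 : v != 0 by rewrite subr_eq0 eq_sym.
have [u0|u0] := eqVneq u 0.
  exists id; split => //; first exact: plhomeo_id.
  rewrite image_id; apply: (@collinear_concat _ _ _ 1) => //.
  by rewrite scale1r; apply/esym/eqP; rewrite -subr_eq0; apply/eqP.
(* [n] will be the component of [v] orthogonal to [u]. If it vanishes the three points are
   collinear; otherwise its multiple [m] gives [v] and [w] the same height 1, and adding [u] times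
   the height turns [w] into [v]. *)
pose mu := dot v u / dot u u.
pose n := v - mu *: u.
have uu : 0 < dot u u by exact: dot_gt0.
have un : dot u n = 0.
  by rewrite dotBr dotZr /mu divfK ?gt_eqF // dotC subrr.
have [n0|n0] := eqVneq n 0.
  exists id; split => //; first exact: plhomeo_id.
  have vE : v = mu *: u by apply/eqP; rewrite -subr_eq0 -/n n0.
  have mu0 : mu != 0 by apply: contraNneq v0 => m0; rewrite vE m0 scale0r.
  rewrite image_id; apply: (@collinear_concat _ _ _ (1 - mu^-1)) => //.
  rewrite -/v -/w scalerBl scale1r {2}vE scalerA mulVf // scale1r /u.
  by rewrite opprB addrC subrK.
have vn : dot v n = dot n n.
  by rewrite -[RHS]/(dot (v - mu *: u) n) [RHS]dotBl dotZl un mulr0 subr0.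
have nn : 0 < dot n n by exact: dot_gt0.
pose m := (dot n n)^-1 *: n.
have um : dot u m = 0 by rewrite dotZr un mulr0.
have vm : dot v m = 1 by rewrite dotZr vn mulVf ?gt_eqF.
have wm : dot w m = 1.
  by have := um; rewrite dotBl vm => /eqP; rewrite subr_eq0 => /eqP.
(* The height above the plane through [b], cut off at 0 so that the first segment, which lies below,
   stays fixed. Both pieces have slope 0 along [u]. *)
pose f : R3 -> R := (fun x => dot x 0 + 0) \max (fun x => dot x m + - dot b m).
have pf : plu u f.
  apply: plu_max; apply: plu_affine; last by rewrite um; lra.
  by rewrite dotC dot0l; lra.
have fE x : f x = Num.max 0 (dot (x - b) m).
  by rewrite /f /= dotC dot0l addr0 dotBl.
have k1 x : segment a b x -> push u f x = x.
  move=> /segmentP[t t01 ->]; rewrite /push fE.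
  rewrite (_ : dot _ m = t - 1).
    by rewrite (max_idPl _) ?scale0r ?addr0 //; lra.
  have -> : a + t *: (b - a) - b = (t - 1) *: v.
    by apply/rowP => i; rewrite !mxE; ring.
  by rewrite dotZl vm mulr1.
have k2 t : 0 <= t -> push u f (b + t *: w) = b + t *: v.
  move=> t0; rewrite /push fE (_ : b + t *: w - b = t *: w); last first.
    by rewrite addrAC subrr add0r.
  rewrite dotZl wm mulr1 (max_idPr t0) -addrA -scalerDr.
  by rewrite [w + u]addrC subrK.
have kc : push u f c = b + v.
  by have := k2 1 ler01; rewrite !scale1r /w [b + (c - b)]addrC subrK.
exists (push u f); split.
- exact: plhomeo_of_push.
- by apply: k1; exact: segment_left.
rewrite kc image_setU (_ : push u f @` segment a b = segment a b); last first.
  apply/seteqP; split=> [_ [x ax <-]|x ax]; first by rewrite k1.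
  by exists x => //; exact: k1.
rewrite (_ : push u f @` segment b c = segment b (b + v)); last first.
  apply/seteqP; split=> [y [x /segmentP[t t01 ->] <-]|x /segmentP[t t01 ->]].
    apply/segmentP; exists t => //; rewrite -/w k2; last lra.
    by rewrite [b + v]addrC addrK.
  exists (b + t *: w); first by apply/segmentP; exists t.
  by rewrite k2 1?[b + v]addrC ?addrK //; lra.
rewrite -segment_cat //; apply/segmentP; exists (1 / 2); first lra.
by rewrite /v; apply/rowP => i; rewrite !mxE; field.
Qed.

(** A push along [p - q] by a small multiple of a function vanishing exactly on [A] slides the line
    through [p] and [q] along itself. The slope bound makes [F] increasing, and [F s < s] because
    the segment leaves [A] at once. *)
Lemma shrink_step A p q : polygonal A -> A p ->
  (forall x, segment p q x -> A x -> x = p) -> p != q ->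
  exists k (F : R -> R), [/\ plhomeo k, forall x, A x -> k x = x, continuous F,
    forall s, k (p + s *: (q - p)) = p + F s *: (q - p) &
    [/\ F 0 = 0, forall s t, s < t -> F s < F t & forall s, 0 < s <= 1 -> F s < s]].
Proof.
move=> /polygonal_pl_closed[rho [prho rho0 rhoA]] Ap pqA pq.
have [e e0 pe] := pl_small (p - q) prho.
pose f x := e * rho x.
exists (push (p - q) f), (fun s => s - f (p + s *: (q - p))); split.
- exact: plhomeo_of_push.
- by move=> x /rhoA ex; rewrite /push /f ex mulr0 scale0r addr0.
- move=> s.
  apply: (@continuousB R R R id (fun s => f (p + s *: (q - p))) s).
    exact: cvg_id.
  apply: (@continuous_comp R R3 R (fun s => p + s *: (q - p)) f).
    apply: (@continuousD R R3 R (cst p) (fun s => s *: (q - p)) s).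
      exact: cst_continuous.
    exact: scalel_continuous.
  exact/pl_continuous/plu_pl/pe.
- by move=> s; rewrite /push; apply/rowP => i; rewrite !mxE; ring.
split.
- by rewrite scale0r addr0 /f (rhoA p).2 // mulr0 subr0.
- move=> s t st; have := plu_increasing p pe st.
  by rewrite -[p - q]opprB !scalerN !opprK.
move=> s s01; suff : 0 < f (p + s *: (q - p)) by lra.
rewrite mulr_gt0 // lt_neqAle rho0 andbT eq_sym; apply/eqP => /rhoA Ax.
have spq : segment p q (p + s *: (q - p)).
  by apply/segmentP; exists s => //; lra.
move/eqP: (pqA _ spq Ax); rewrite -subr_eq0 addrAC subrr add0r scaler_eq0.
rewrite gt_eqF /=; last lra.
by rewrite subr_eq0 eq_sym (negbTE pq).
Qed.

(** The step is iterated. On [[m, 1]] the decrease [t - F t] has a positive minimum, so finitely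
    many iterations bring the end point below [m], the smaller of [sig] and 1. *)
Lemma shrink A p q (sig : R) : polygonal A -> A p ->
  (forall x, segment p q x -> A x -> x = p) -> p != q -> 0 < sig ->
  exists k s, [/\ plhomeo k, forall x, A x -> k x = x, 0 < s < sig /\ s <= 1,
    k q = p + s *: (q - p) & k @` segment p q = segment p (k q)].
Proof.
move=> pA Ap pqA pq sig0.
have [k [F [hk kA cF kF [F0 Fmon Flt]]]] := shrink_step pA Ap pqA pq.
have Fpos s : 0 < s -> 0 < F s by move=> s0; rewrite -F0; exact: Fmon.
have kseg s : 0 < s -> k @` segment p (p + s *: (q - p)) =
    segment p (p + F s *: (q - p)).
  move=> s0; have Fs := Fpos s s0.
  apply/seteqP; split=> [y [x /segmentP[t t01 ->] <-]|x /segmentP[t t01 ->]].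
    rewrite addrAC subrr add0r scalerA kF; apply/segmentP.
    exists (F (t * s) / F s); last first.
      by rewrite addrAC subrr add0r scalerA divfK ?gt_eqF.
    rewrite ler_pdivrMr // ler_pdivlMr // mul0r mul1r.
    have mono r1 r2 : r1 <= r2 -> F r1 <= F r2.
      by rewrite le_eqVlt => /orP[/eqP -> //|/Fmon/ltW].
    by rewrite -{1}F0 !mono //; nra.
  have [|||r rs Fr] := @IVT _ F 0 s (t * F s).
  - exact: ltW.
  - exact: continuous_subspaceT.
  - by rewrite F0 ge_min le_max; apply/andP; split; apply/orP;
      [left|right]; nra.
  exists (p + r *: (q - p)); last first.
    by rewrite kF Fr addrAC subrr add0r scalerA.
  move: rs; rewrite in_itv /= => rs; apply/segmentP; exists (r / s).
    by rewrite ler_pdivrMr // ler_pdivlMr // mul0r mul1r.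
  by rewrite addrAC subrr add0r scalerA divfK ?gt_eqF.
pose m := Num.min sig 1.
have m0 : 0 < m by rewrite lt_min sig0 ltr01.
have m1 : m <= 1 by rewrite ge_min lexx orbT.
have ms : m <= sig by rewrite ge_min lexx.
have [c cm cmin] : exists2 c, c \in `[m, 1] &
    forall t, t \in `[m, 1] -> c - F c <= t - F t.
  apply: (@EVT_min _ (fun t => t - F t)) => //.
  apply: continuous_subspaceT => t.
  by apply: (@continuousB R R R id F t); [exact: cvg_id|exact: cF].
have d0 : 0 < c - F c.
  by rewrite subr_gt0; apply: Flt; move: cm; rewrite in_itv /=; lra.
(* After [n] iterations the end is either already below [m] or has moved by at least [n] times the
   minimal decrease. *)
have step (n : nat) : exists h s, [/\ plhomeo h, forall x, A x -> h x = x,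
    0 < s <= 1, h q = p + s *: (q - p) /\ h @` segment p q = segment p (h q) &
    s < m \/ s <= 1 - (c - F c) * n%:R].
  elim: n => [|n [h [s [hh hA s01 [hq hpq] hs]]]].
    exists id, 1; split => //; rewrite ?ltr01 ?lexx //; first exact: plhomeo_id.
    - by split; rewrite ?image_id // scale1r addrC subrK.
    - by right; rewrite mulr0 subr0.
  exists (k \o h), (F s); split.
  - exact: plhomeo_comp.
  - by move=> x Ax /=; rewrite hA // kA.
  - by rewrite Fpos; [have := Flt s s01; lra|lra].
  - split; first by rewrite /= hq kF.
    by rewrite -image_comp hpq hq kseg /=; [rewrite hq kF|lra].
  have Fs := Flt s s01.
  case: hs => [sm|sn]; first by left; lra.
  have [sm|sm] := ltP s m; first by left; lra.
  right; have := cmin s; rewrite in_itv /= sm; move=> /(_ _) cs.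
  have := cs (andP s01).2; rewrite -natr1; nra.
pose n := Num.bound ((c - F c)^-1).
have [h [s [hh hA s01 [hq hpq] hs]]] := step n.
exists h, s; split => //; split; last lra.
case: hs => [|sn]; first lra.
have : 1 < (c - F c) * n%:R.
  have hn : (c - F c)^-1 < n%:R by apply: archi_boundP; rewrite invr_ge0 ltW.
  by have := mulfV (lt0r_neq0 d0); nra.
lra.
Qed.


(** Only the image of the initial arc has to become a segment; how it is traversed is left free. *)
Definition straightenable gam t := exists2 g, plhomeo g &
  g @` (gam @` `[0, t]) = segment (g (gam 0)) (g (gam t)).

Lemma itv_split (gam : R -> R3) (r s t : R) : r <= s <= t ->
  gam @` `[r, t] = gam @` `[r, s] `|` gam @` `[s, t].
Proof.
move=> rst; rewrite -image_setU; congr (_ @` _).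
apply/seteqP; split=> x /=; rewrite !in_itv /=.
  by move=> hx; have [xs|sx] := leP x s; [left|right]; lra.
by case; lra.
Qed.

Lemma straightenable0 gam : straightenable gam 0.
Proof.
exists id; first exact: plhomeo_id.
rewrite set_itv1 !image_set1; apply/seteqP; split=> [x ->|x /segmentP[t _ ->]].
  exact: segment_left.
by rewrite subrr scaler0 addr0.
Qed.

(** Once the arc is straight up to [t], it goes on for a while along a second segment meeting the
    first only at their common end, and [bend] merges the two. *)
Lemma straightenable_right gam t : pl_arc gam -> 0 <= t < 1 ->
  straightenable gam t -> exists t', [/\ t < t', t' <= 1 &
    forall s, t < s <= t' -> straightenable gam s].
Proof.
move=> ag t01 [g hg gt].
have agg := pl_arc_plhomeo hg ag.
have [t' [tt' t'1 H]] := arc_right_straight agg t01.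
exists t'; split => // s ts; have Hs := H s ts.
(* At 0 the first segment is a point, so there is nothing to bend. *)
have [t0|t_neq0] := eqVneq t 0.
  exists g => //; rewrite image_comp -t0.
  exact: Hs.
have t_gt0 : 0 < t by rewrite lt_neqAle eq_sym t_neq0; lra.
have [_ ig _] := agg.
have sE : g @` (gam @` `[0, s]) =
    segment (g (gam 0)) (g (gam t)) `|` segment (g (gam t)) (g (gam s)).
  rewrite (@itv_split _ 0 t s); last lra.
  by rewrite image_setU gt [X in _ `|` X]image_comp Hs.
have [|||k [hk ka kE]] := @bend (g (gam 0)) (g (gam t)) (g (gam s)).
- by apply/eqP => /ig; lra.
- by apply/eqP => /ig; lra.
- rewrite -gt -Hs image_comp => x [r1 /=]; rewrite in_itv /= => r1t <-.
  move=> [r2 /=]; rewrite in_itv /= => r2t /ig e.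
  have {}e : r2 = r1 by apply: e; lra.
  by have -> : r1 = t by lra.
by exists (k \o g); [exact: plhomeo_comp|rewrite -image_comp sE kE /= ka].
Qed.

Lemma segment_cat_meet a b c x : segment a b c ->
  segment a c x -> segment c b x -> x = c.
Proof.
move=> /segmentP[r r01 cE] /segmentP[s s01 xs] /segmentP[t t01 xt].
have [ab|ab] := eqVneq b a.
  by rewrite xt cE ab subrr scaler0 addr0 subrr scaler0 addr0.
have e1 : x - a = (s * r) *: (b - a).
  by rewrite xs addrAC subrr add0r cE addrAC subrr add0r scalerA.
have e2 : x - a = (r + t * (1 - r)) *: (b - a).
  by rewrite xt cE; apply/rowP => i; rewrite !mxE; ring.
have : (s * r - (r + t * (1 - r))) *: (b - a) = 0 by rewrite scalerBl -e1 -e2 subrr.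
move/eqP; rewrite scaler_eq0 [b - a == 0]subr_eq0 (negbTE ab) orbF => /eqP e.
have : t * (1 - r) = 0 by nra.
move=> t0; rewrite xt cE; apply/rowP => i; rewrite !mxE.
suff -> : t * (b ord0 i - (a ord0 i + r * (b ord0 i - a ord0 i))) =
  t * (1 - r) * (b ord0 i - a ord0 i) by rewrite t0 mul0r addr0.
by ring.
Qed.

(** Local straightness on the left of [t] concerns pieces ending at [t], whereas the shrinking
    argument needs a piece ending earlier. Injectivity separates the tail from the rest of the
    segment. *)
Lemma straight_initial gam s w t : pl_arc gam -> 0 <= s -> s <= w < t -> t <= 1 ->
  gam @` `[s, t] = segment (gam s) (gam t) ->
  gam @` `[w, t] = segment (gam w) (gam t) ->
  gam @` `[s, w] = segment (gam s) (gam w).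
Proof.
move=> [_ ig _] s0 swt t1 Hs Hw.
have sw : segment (gam s) (gam t) (gam w).
  by rewrite -Hs; exists w => //=; rewrite in_itv /=; lra.
apply/seteqP; split=> [y [r /=]|x xsw].
  rewrite in_itv /= => hr <-.
  have : segment (gam s) (gam t) (gam r).
    by rewrite -Hs; exists r => //=; rewrite in_itv /=; lra.
  rewrite (segment_cat sw) => -[//|]; rewrite -Hw => -[r' /=].
  rewrite in_itv /= => hr' /ig e.
  have {}e : r' = r by apply: e; lra.
  have -> : r = w by lra.
  exact: segment_right.
have : segment (gam s) (gam t) x.
  by rewrite (segment_cat sw); left.
rewrite -Hs => -[r /=]; rewrite in_itv /= => hr xr.
exists r => //=; rewrite in_itv /= (andP hr).1 /= leNgt; apply/negP => wr.
have : segment (gam w) (gam t) x.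
  by rewrite -Hw; exists r => //=; rewrite in_itv /=; lra.
move=> /(segment_cat_meet sw xsw); rewrite -xr => /ig; lra.
Qed.

(* A straight last segment can be shrunk, fixing the rest of the arc, until its
   end lies in the range covered by the previous lemma. *)
Lemma straightenable_left gam t : pl_arc gam -> 0 < t <= 1 -> exists t',
  [/\ 0 <= t', t' < t & forall s, t' <= s < t -> straightenable gam s ->
    straightenable gam t].
Proof.
move=> ag t01; have [cg ig pg] := ag.
have [t' [t'0 t't H]] := arc_left_straight ag t01.
exists t'; split => // s st Ts.
have Hs := H s st.
have [|t'' [st'' t''1 H'']] := straightenable_right ag _ Ts; first lra.
(* Only the whole arc is given as polygonal; for the initial part this follows from its being the
   image of a segment under the inverse straightening. *)
have pA : polygonal (gam @` `[0, s]).
  have [g hg gs] := Ts; have [k hk [gK _]] := plhomeo_inverse hg.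
  suff -> : gam @` `[0, s] = k @` segment (g (gam 0)) (g (gam s)).
    exact/polygonal_plhomeo/polygonal_segment.
  rewrite -gs image_comp (_ : k \o g = id) ?image_id //.
  by apply/funext => x /=; rewrite gK.
have Ap : (gam @` `[0, s]) (gam s) by exists s; rewrite //= in_itv /=; lra.
have Ainter x : segment (gam s) (gam t) x -> (gam @` `[0, s]) x -> x = gam s.
  rewrite -Hs => -[r1 /=]; rewrite in_itv /= => r1s <-.
  move=> [r2 /=]; rewrite in_itv /= => r2s /ig e.
  have {}e : r2 = r1 by apply: e; lra.
  by have -> : r1 = s by lra.
have neq : gam s != gam t by apply/eqP => /ig; lra.
(* [gam r] lies on the last segment, at parameter [sig], and within reach of the extension to the
   right. Shrinking below [sig] moves the end to some [gam w] with [w <= r], so the whole arc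
   becomes one already known to be straightenable. *)
pose r := Num.min t'' t.
have sr : s < r by rewrite lt_min st''; lra.
have rt : r <= t by rewrite ge_min lexx orbT.
have rt'' : r <= t'' by rewrite ge_min lexx.
have : segment (gam s) (gam t) (gam r).
  by rewrite -Hs; exists r => //=; rewrite in_itv /= rt ltW.
move=> /segmentP[sig sig01 er].
have sig0 : 0 < sig.
  rewrite lt_neqAle (andP sig01).1 andbT eq_sym; apply/eqP => s0.
  by move: er; rewrite s0 scale0r addr0 => /ig; lra.
have [k [z [hk kA [zsig z1] kq kE]]] := shrink pA Ap Ainter neq sig0.
have : segment (gam s) (gam t) (k (gam t)).
  by rewrite kq; apply/segmentP; exists z => //; lra.
rewrite -Hs => -[w /=]; rewrite in_itv /= => ws ew.
have sw : s < w.
  rewrite lt_neqAle (andP ws).1 andbT; apply/eqP => sw.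
  move/eqP: ew; rewrite kq -sw -subr_eq0 opprD addrA subrr add0r oppr_eq0.
  by rewrite scaler_eq0 subr_eq0 [gam t == _]eq_sym (negbTE neq) orbF gt_eqF; lra.
have Hw : gam @` `[s, w] = segment (gam s) (gam w).
  have [wt|tw] := ltP w t; last by have -> : w = t by lra.
  by apply: (@straight_initial _ s w t) => //; [lra|lra|lra|apply: H; lra].
have wr : w <= r.
  rewrite leNgt; apply/negP => rw.
  have : segment (gam s) (gam w) (gam r).
    by rewrite -Hw; exists r => //=; rewrite in_itv /=; lra.
  move=> /segmentP[tau tau01]; rewrite ew kq er addrAC subrr add0r scalerA.
  move/addrI/eqP; rewrite -subr_eq0 -scalerBl scaler_eq0 subr_eq0.
  rewrite [gam t - _ == 0]subr_eq0 [gam t == _]eq_sym (negbTE neq) orbF.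
  by move/eqP; nra.
have [g hg gE] : straightenable gam w by apply: H''; lra.
exists (g \o k); first exact: plhomeo_comp.
have k0 : k (gam 0) = gam 0.
  by apply: kA; exists 0; rewrite //= in_itv /=; lra.
rewrite -image_comp (@itv_split _ 0 s t); last lra.
rewrite [k @` _]image_setU Hs kE -ew -Hw (_ : k @` _ = gam @` `[0, s]).
  by rewrite -itv_split; [rewrite gE /= k0 ew|lra].
apply/seteqP; split=> [_ [x Ax <-]|x Ax]; first by rewrite kA.
by exists x => //; exact: kA.
Qed.

(** The supremum of the straightenable parameters is itself one by extension from the left, and
    extension to the right forces it to be 1. *)
Lemma straightenable1 gam : pl_arc gam -> straightenable gam 1.
Proof.
move=> ag; pose S := [set t | 0 <= t <= 1 /\ straightenable gam t].
have S0 : S 0 by split; [rewrite lexx ler01|exact: straightenable0].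
have supS : has_sup S.
  by split; [exists 0|exists 1 => t [/andP[]]].
have le_sup t : S t -> t <= sup S by move=> St; exact: sup_upper_bound.
have sup1 : sup S <= 1 by apply: ge_sup => [|t [/andP[]] //]; exists 0.
have sup0 := le_sup _ S0.
have Tsup : straightenable gam (sup S).
  have [->|s_neq0] := eqVneq (sup S) 0; first exact: straightenable0.
  have s_gt0 : 0 < sup S by rewrite lt_neqAle eq_sym s_neq0.
  have [|t' [t'0 t's H]] := straightenable_left (t := sup S) ag; first lra.
  have st'_gt0 : 0 < sup S - t' by lra.
  have [s Ss] := sup_adherent st'_gt0 supS.
  have := le_sup _ Ss; rewrite opprB addrCA subrr addr0.
  rewrite le_eqVlt => /orP[/eqP <- _|s1 s2]; first by have [] := Ss.
  by apply: (H s); [lra|have [] := Ss].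
have [<- //|neq1] := eqVneq (sup S) 1.
have [|t' [st' t'1 H]] := straightenable_right ag _ Tsup.
  by rewrite sup0 lt_neqAle neq1.
have : t' <= sup S by apply: le_sup; split; [lra|apply: H; lra].
lra.
Qed.

End Straighten.

(** * Parallel copies of edges *)

Section PushOff.
Variable R : realType.
Local Notation R3 := 'rV[R]_3.
Implicit Types (h g : R3 -> R3) (f : R3 -> R) (A B K Z : set R3).
Implicit Types (x y u a b c d n : R3) (s t : R).

Lemma pl_small_all f u : pl f ->
  exists2 e, 0 < e & forall r, 0 < r <= e -> plu u (fun x => r * f x).
Proof.
move=> pf; have [e e0 pe] := pl_small u pf; exists e => // r /andP[r0 re].
rewrite (_ : (fun x => r * f x) = (fun x => r / e * (e * f x))).
  apply: plu_scale pe; rewrite ler_pdivrMr // mul1r re andbT.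
  by rewrite divr_ge0 // ltW.
by apply/funext => x; rewrite mulrA divfK ?gt_eqF.
Qed.

Lemma pl_directional_lipschitz f u : pl f -> exists2 L, 0 <= L &
  forall x s, `|f (x + s *: u) - f x| <= L * `|s|.
Proof.
elim=> [a c|f1 f2 _ [L1 L10 H1] _ [L2 L20 H2]|f1 f2 _ [L1 L10 H1] _ [L2 L20 H2]].
- exists `|dot u a| => // x s; rewrite dotDl dotZl -normrM.
  by rewrite le_eqVlt; apply/orP; left; apply/eqP; congr `|_|; ring.
- exists (L1 + L2) => [|x s /=]; first exact: addr_ge0.
  move: (H1 x s) (H2 x s) (normr_ge0 s); rewrite !ler_norml mulrDl.
  move: (mulr_ge0 L10 (normr_ge0 s)) (mulr_ge0 L20 (normr_ge0 s)).
  case: (leP (f1 (x + s *: u))); case: (leP (f1 x)); lra.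
- exists (L1 + L2) => [|x s /=]; first exact: addr_ge0.
  move: (H1 x s) (H2 x s) (normr_ge0 s); rewrite !ler_norml mulrDl.
  move: (mulr_ge0 L10 (normr_ge0 s)) (mulr_ge0 L20 (normr_ge0 s)).
  case: (leP (f1 (x + s *: u))); case: (leP (f1 x)); lra.
Qed.

Lemma finite_small (I : eqType) (l : seq I) (P : I -> R -> Prop) :
  (forall i, i \in l -> exists2 e, 0 < e & forall r, 0 < r <= e -> P i r) ->
  exists2 e, 0 < e & forall i r, i \in l -> 0 < r <= e -> P i r.
Proof.
elim: l => [|i l IH] H; first by exists 1.
have [e1 e10 H1] := H i (mem_head _ _).
have [|e2 e20 H2] := IH; first by move=> j jl; apply: H; rewrite inE jl orbT.
exists (Num.min e1 e2) => [|j r]; first by rewrite lt_min e10.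
rewrite inE le_min => /orP[/eqP ->|jl] /and3P[r0 r1 r2].
  by apply: H1; rewrite r0.
by apply: H2; rewrite ?r0.
Qed.

(** A 3 by 2 matrix has a nonzero left kernel. Unlike the cross product, this also covers parallel
    or zero vectors. *)
Lemma common_normal a b : exists2 n, n != 0 & dot a n = 0 /\ dot b n = 0.
Proof.
pose A : 'M[R]_(3, 2) := \matrix_(i, j) (if j == ord0 then a else b) ord0 i.
have k0 : kermx A != 0.
  rewrite -mxrank_eq0 mxrank_ker -lt0n subn_gt0.
  exact: leq_ltn_trans (rank_leq_col A) _.
exists (nz_row (kermx A)); first by rewrite nz_row_eq0.
have : nz_row (kermx A) *m A = 0.
  by apply/sub_kermxP; exact: nz_row_sub.
move=> /rowP nA; split.
  move: (nA ord0); rewrite !mxE => e; rewrite -[RHS]e; apply: eq_bigr => i _.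
  by rewrite !mxE /= mulrC.
move: (nA ord_max); rewrite !mxE => e; rewrite -[RHS]e; apply: eq_bigr => i _.
by rewrite !mxE /= mulrC.
Qed.

(** If [u] lies in the new plane, a multiple of its normal is added; each old plane excludes at most
    one coefficient. *)
Lemma avoid_planes (l : seq R3) : (forall n, n \in l -> n != 0) ->
  exists u, forall n, n \in l -> dot u n != 0.
Proof.
elim: l => [|n l IH] l0; first by exists 0.
have [|u Hu] := IH; first by move=> m ml; apply: l0; rewrite inE ml orbT.
have n0 : n != 0 by apply: l0; rewrite mem_head.
have [un|un] := eqVneq (dot u n) 0; last first.
  by exists u => m; rewrite inE => /orP[/eqP ->|/Hu].
have [e /andP[e0 _] He] :=
  finite_avoid [seq - dot u m / dot n m | m <- l] (@ltr01 R).
exists (u + e *: n) => m; rewrite inE dotDl dotZl => /orP[/eqP ->|ml].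
  by rewrite un add0r mulf_neq0 ?gt_eqF // dot_gt0.
have [nm|nm] := eqVneq (dot n m) 0; first by rewrite nm mulr0 addr0 Hu.
apply: contra He; rewrite addrC addr_eq0 => /eqP em.
by apply/mapP; exists m => //; rewrite -em mulfK.
Qed.

Lemma segment_continuous f a b : continuous f ->
  continuous (fun t : R => f (a + t *: (b - a))).
Proof.
move=> cf t; apply: (@continuous_comp R R3 R (fun s => a + s *: (b - a)) f).
  apply: (@continuousD R R3 R (cst a) (fun s => s *: (b - a)) t).
    exact: cst_continuous.
  exact: scalel_continuous.
exact: cf.
Qed.

(* For intersecting segments the translation direction u is transverse to the
   plane they span; disjoint segments are at positive distance. *)
Lemma push_off A B : polygonal A -> polygonal B -> exists h, [/\ plhomeo h,
  forall x, A x -> h x = x & forall x, B x -> ~ A x -> ~ B (h x)].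
Proof.
move=> /polygonal_pl_closed[rho [prho rho0 rhoA]] [l lB].
pose nrm (w : (R3 * R3) * (R3 * R3)) :=
  sval (cid2 (common_normal (w.1.2 - w.1.1) (w.2.2 - w.2.1))).
have nrmP w : [/\ nrm w != 0, dot (w.1.2 - w.1.1) (nrm w) = 0 &
    dot (w.2.2 - w.2.1) (nrm w) = 0].
  by rewrite /nrm; case: cid2 => n /= n0 [].
pose pairs := [seq (w, w') | w <- l, w' <- l].
have [u Hu] : exists u, forall n, n \in [seq nrm w | w <- pairs] -> dot u n != 0.
  by apply: avoid_planes => n /mapP[w _ ->]; have [] := nrmP w.
pose P (w : (R3 * R3) * (R3 * R3)) (e : R) := forall x,
  segment w.1.1 w.1.2 x -> segment w.2.1 w.2.2 (x + (e * rho x) *: u) -> rho x = 0.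
have [e1 e10 He1] : exists2 e, 0 < e &
    forall w r, w \in pairs -> 0 < r <= e -> P w r.
  apply: finite_small => w wp.
  have [[z [/segmentP[r1 _ z1] /segmentP[r2 _ z2]]]|disj] :=
      pselect (exists z, segment w.1.1 w.1.2 z /\ segment w.2.1 w.2.2 z).
    exists 1 => // r /andP[r0 _] x /segmentP[r3 _ x3] /segmentP[r4 _ x4].
    have [_ n1 n2] := nrmP w.
    have nu : dot u (nrm w) != 0 by apply: Hu; exact: map_f.
    have : r * rho x * dot u (nrm w) = 0.
      have -> : r * rho x * dot u (nrm w) =
          dot (x + (r * rho x) *: u - z) (nrm w) - dot (x - z) (nrm w).
        by rewrite !dotBl dotDl dotZl; ring.
      have -> : x - z = (r3 - r1) *: (w.1.2 - w.1.1).
        by rewrite z1 x3 opprD addrACA subrr add0r scalerBl.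
      have -> : x + (r * rho x) *: u - z = (r4 - r2) *: (w.2.2 - w.2.1).
        by rewrite z2 x4 opprD addrACA subrr add0r scalerBl.
      by rewrite !dotZl n1 n2 !mulr0 subrr.
    move/eqP; rewrite !mulf_eq0 (negbTE nu) orbF gt_eqF //=.
    by move/eqP.
  have [rho' [prho' rho'0 rho'w]] := pl_closed_segment w.2.1 w.2.2.
  have [L L0 HL] := pl_directional_lipschitz u prho'.
  have [|t1 t1i t1min] := @EVT_min _ (fun t => rho' (w.1.1 + t *: (w.1.2 - w.1.1)))
      0 1 ler01.
    by apply: continuous_subspaceT; apply: segment_continuous; exact: pl_continuous.
  have [|t2 t2i t2max] := @EVT_max _ (fun t => rho (w.1.1 + t *: (w.1.2 - w.1.1)))
      0 1 ler01.
    by apply: continuous_subspaceT; apply: segment_continuous; exact: pl_continuous.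
  move: t1min t2max; set c := rho' _; set M := rho _ => t1min t2max.
  have c0 : 0 < c.
    rewrite lt_neqAle rho'0 andbT eq_sym; apply/eqP => /rho'w t1w.
    apply: disj; exists (w.1.1 + t1 *: (w.1.2 - w.1.1)); split => //.
    by apply/segmentP; exists t1 => //; move: t1i; rewrite in_itv.
  have M0 : 0 <= M by exact: rho0.
  have LM : 0 < L * M + 1 by rewrite ltr_wpDl // mulr_ge0.
  (* Here [c] bounds [rho'] from below and [M] bounds [rho] from above on the first segment. The
     displacement changes [rho'] by at most [r * L * M], less than [c], so the second segment is not
     reached; the [+ 1] keeps the denominator positive. *)
  exists (c / 2 / (L * M + 1)); first by rewrite !divr_gt0.
  move=> r /andP[r0]; rewrite ler_pdivlMr // => rLM x /segmentP[t t01 xE] xw'.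
  exfalso; have := HL x (r * rho x); rewrite (rho'w _).2 // sub0r normrN.
  rewrite !ger0_norm ?mulr_ge0 ?rho0 ?(ltW r0) //.
  have : c <= rho' x by rewrite xE; apply: t1min; rewrite in_itv.
  have : rho x <= M by rewrite xE; apply: t2max; rewrite in_itv.
  move=> h1 h2 h3.
  have : L * (r * rho x) <= r * (L * M).
    by rewrite mulrCA; apply: ler_wpM2l; [exact: ltW|exact: ler_wpM2l].
  nra.
have [e2 e20 He2] := pl_small_all u prho.
pose e := Num.min e1 e2.
have e0 : 0 < e by rewrite lt_min e10.
exists (push u (fun x => e * rho x)); split.
- by apply: plhomeo_of_push; apply: He2; rewrite e0 ge_min lexx orbT.
- by move=> x /rhoA rx; rewrite /push rx mulr0 scale0r addr0.
move=> x Bx nAx Bhx; apply: nAx; apply/rhoA.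
move: Bx Bhx; rewrite lB => -[w wl xw] [w' w'l xw'].
have e1P : 0 < e <= e1 by rewrite e0 ge_min lexx.
by apply: (He1 (w, w') e _ e1P); rewrite // allpairs_f.
Qed.

End PushOff.

(** * Planar bigons are unknotted *)

Section PlanarBigon.
Variable R : realType.
Local Notation R3 := 'rV[R]_3.
Implicit Types (h g : R3 -> R3) (f : R3 -> R) (A B K Z : set R3).
Implicit Types (x y u a b c d n : R3) (s t : R).

Local Notation i0 := (inord 0 : 'I_3).
Local Notation i1 := (inord 1 : 'I_3).
Local Notation i2 := (inord 2 : 'I_3).

Definition e1 : R3 := delta_mx ord0 i0.
Definition e2 : R3 := delta_mx ord0 i1.

Lemma inord_eq (j k : nat) : (j < 3)%N -> (k < 3)%N ->
  (inord j == inord k :> 'I_3) = (j == k).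
Proof. by move=> j3 k3; rewrite -val_eqE /= !inordK. Qed.

Lemma row3P x y : x ord0 i0 = y ord0 i0 -> x ord0 i1 = y ord0 i1 ->
  x ord0 i2 = y ord0 i2 -> x = y.
Proof.
move=> h0 h1 h2; apply/rowP => -[[|[|[|//]]] k].
- by rewrite (_ : Ordinal k = i0) //; apply/val_inj; rewrite /= inordK.
- by rewrite (_ : Ordinal k = i1) //; apply/val_inj; rewrite /= inordK.
- by rewrite (_ : Ordinal k = i2) //; apply/val_inj; rewrite /= inordK.
Qed.

Lemma addZ_e2 x t : [/\ (x + t *: e2) ord0 i0 = x ord0 i0,
  (x + t *: e2) ord0 i1 = x ord0 i1 + t & (x + t *: e2) ord0 i2 = x ord0 i2].
Proof.
rewrite !mxE !inord_eq //=.
by rewrite !mulr0 !mulr1 !addr0.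
Qed.

Lemma segment_e1 : segment (- e1) e1 =
  [set x : R3 | [/\ -1 <= x ord0 i0 <= 1, x ord0 i1 = 0 & x ord0 i2 = 0]].
Proof.
apply/seteqP; split=> x.
  move=> /segmentP[t t01 ->] /=; rewrite !mxE !inord_eq //=.
  by split; [lra|ring|ring].
move=> [x0 x1 x2]; apply/segmentP; exists ((x ord0 i0 + 1) / 2); first lra.
by apply: row3P; rewrite !mxE !inord_eq //= ?x1 ?x2; lra.
Qed.

Lemma e1_neq0 : e1 != 0.
Proof.
apply/eqP => /rowP/(_ i0); rewrite !mxE !eqxx /= => /eqP.
by rewrite oner_eq0.
Qed.

Lemma affine_push_segment u m (c : R) a b :
  push u (fun x => dot x m + c) @` segment a b =
  segment (push u (fun x => dot x m + c) a) (push u (fun x => dot x m + c) b).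
Proof. by apply: push_segment => t _; rewrite !dotDl dotZl dotBl; ring. Qed.

(** The condition [0 < dot e1 m] is the slope bound for the push along [e1 - d] up to sign, which
    takes the signed [d] to [e1]. The sign is unavoidable: no [m] is positive on both [e1] and a
    negative multiple of it. *)
Lemma align_vector d : d != 0 -> exists m (sg : bool),
  dot ((-1) ^+ sg *: d) m = 1 /\ 0 < dot e1 m.
Proof.
move=> d0; have e1e1 : dot e1 e1 = 1 by rewrite dot_delta mxE !eqxx.
have [d00|d00] := eqVneq (d ord0 i0) 0.
  have /rV0Pn[k dk] := d0.
  have k0 : k != i0 by apply: contraNneq dk => ->; rewrite d00.
  exists (e1 + (d ord0 k)^-1 *: delta_mx ord0 k), false.
  rewrite scale1r ![dot _ (_ + _)]dotC !dotDl !dotZl e1e1 ![dot _ d]dotC.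
  rewrite !dot_delta d00 add0r mulVf //; split=> //.
  by rewrite mxE [i0 == k]eq_sym (negbTE k0) andbF mulr0 addr0 ltr01.
exists (`|d ord0 i0|^-1 *: e1), (d ord0 i0 < 0).
rewrite !dotZr e1e1 mulr1 invr_gt0 normr_gt0; split=> //.
by rewrite dotZl dot_delta -normrEsign mulVf // normr_eq0.
Qed.

(** The midpoint is translated to the origin and half the difference vector is aligned with the
    first axis. The target is symmetric, so [sg] only records which end goes where. *)
Lemma normalise_segment a b : a != b -> exists g (sg : bool), [/\ plhomeo g,
  g a = (-1) ^+ sg *: - e1, g b = (-1) ^+ sg *: e1 &
  g @` segment a b = segment (- e1) e1].
Proof.
move=> ab; pose d := 2^-1 *: (b - a).
have d0 : d != 0.
  by rewrite scaler_eq0 invr_eq0 pnatr_eq0 /= subr_eq0 eq_sym.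
have [m [sg [dm em]]] := align_vector d0.
pose g1 := push (- (2^-1 *: (a + b))) (fun x => dot x 0 + 1).
have g1E x : g1 x = x - 2^-1 *: (a + b).
  by rewrite /g1 /push dotC dot0l add0r scale1r.
have g1a : g1 a = - d by rewrite g1E; apply/rowP => i; rewrite !mxE; field.
have g1b : g1 b = d by rewrite g1E; apply/rowP => i; rewrite !mxE; field.
pose u := e1 - (-1) ^+ sg *: d.
pose g2 := push u (fun x => dot x m + 0).
have g2d : g2 ((-1) ^+ sg *: d) = e1.
  by rewrite /g2 /push dm addr0 scale1r addrC subrK.
have g2dN : g2 (- ((-1) ^+ sg *: d)) = - e1.
  by rewrite /g2 /push dotNl dm addr0 scaleN1r opprB addKr.
have [g2a g2b] : g2 (- d) = (-1) ^+ sg *: - e1 /\ g2 d = (-1) ^+ sg *: e1.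
  move: g2d g2dN; move: (g2) => k; case: (sg) => /=.
    by rewrite !expr1 !scaleN1r !opprK.
  by rewrite !expr0 !scale1r.
exists (g2 \o g1), sg; split.
- apply: plhomeo_comp; apply: plhomeo_of_push; apply: plu_affine.
    by rewrite dotBl dm; lra.
  by rewrite dotC dot0l; lra.
- by rewrite /= g1a.
- by rewrite /= g1b.
rewrite -image_comp affine_push_segment -/g1 g1a g1b affine_push_segment -/g2.
rewrite g2a g2b; case: (sg) => /=; rewrite ?expr0 ?scale1r //.
by rewrite expr1 !scaleN1r opprK segment_sym.
Qed.

(* Maps [0, p] onto [0, c] and is the identity if p = c = 0, since y / 0 = 0. *)
Definition stretch (p c y : R) := y + (c - p) * clamp (y / p).

Lemma stretchK (p c y : R) : 0 <= p -> 0 <= c -> (0 < p) = (0 < c) ->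
  stretch c p (stretch p c y) = y.
Proof.
move=> p0 c0 pc; rewrite /stretch.
have [p_gt0|p_le0] := ltP 0 p; last first.
  have -> : p = 0 by apply/eqP; rewrite eq_le p_le0.
  have -> : c = 0 by apply/eqP; rewrite eq_le c0 andbT leNgt -pc -leNgt.
  by rewrite !subrr !mul0r !addr0.
have c_gt0 : 0 < c by rewrite -pc.
have clamp_le0 (r : R) : r <= 0 -> clamp r = 0.
  by move=> r0; rewrite /clamp; apply/max_idPl; rewrite ge_min r0 orbT.
have clamp_ge1 (r : R) : 1 <= r -> clamp r = 1.
  by move=> r1; rewrite /clamp (min_idPl r1); apply/max_idPr.
have [y0|y0] := leP y 0.
  by rewrite !clamp_le0 ?mulr0 ?addr0 ?pmulr_lle0 ?invr_gt0.
have [yp|yp] := leP y p.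
  rewrite (clampE (t := y / p)); last by rewrite ler_pdivlMr // ler_pdivrMr //; lra.
  have -> : y + (c - p) * (y / p) = c * (y / p) by field; rewrite gt_eqF.
  rewrite mulrAC divff ?gt_eqF // mul1r clampE; last first.
    by rewrite ler_pdivlMr // ler_pdivrMr //; lra.
  by field; rewrite gt_eqF.
rewrite (@clamp_ge1 (y / p)); last by rewrite ler_pdivlMr //; lra.
by rewrite clamp_ge1; [ring|rewrite ler_pdivlMr //; lra].
Qed.

Lemma coordinate_continuous (i : 'I_3) : continuous (fun x : R3 => x ord0 i).
Proof. by move=> x; exact: coord_continuous. Qed.

Lemma comp_coordinate_continuous (k : R -> R) (i : 'I_3) : continuous k ->
  continuous (fun x : R3 => k (x ord0 i)).
Proof.
move=> ck x; apply: (@continuous_comp R3 R R (fun x : R3 => x ord0 i) k).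
  exact: coordinate_continuous.
exact: ck.
Qed.

Section Stretch.
Variables psi chi : R -> R.
Hypotheses (cpsi : continuous psi) (cchi : continuous chi).
Hypotheses (psi0 : forall s, 0 <= psi s) (chi0 : forall s, 0 <= chi s).
Hypothesis (psichi : forall s, (0 < psi s) = (0 < chi s)).

(** The displacement that performs [stretch (psi s) (chi s)] on the second coordinate over each
    value [s] of the first. *)
Definition stretch_height x : R :=
  (chi (x ord0 i0) - psi (x ord0 i0)) * clamp (x ord0 i1 / psi (x ord0 i0)).

(** Where [psi] vanishes the quotient may jump, but the clamp keeps its factor in [[0, 1]] while
    [chi - psi] tends to 0. *)
Lemma stretch_height_continuous : continuous stretch_height.
Proof.
have cd : continuous (fun x : R3 => chi (x ord0 i0) - psi (x ord0 i0)).
  move=> x; apply: (@continuousB R R R3 (fun x : R3 => chi (x ord0 i0))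
    (fun x : R3 => psi (x ord0 i0)) x).
    exact: comp_coordinate_continuous.
  exact: comp_coordinate_continuous.
move=> x; have [p_gt0|p_le0] := ltP 0 (psi (x ord0 i0)).
  apply: (@continuousM R R3 (fun x : R3 => chi (x ord0 i0) - psi (x ord0 i0))
    (fun x : R3 => clamp (x ord0 i1 / psi (x ord0 i0))) x); first exact: cd.
  apply: (@continuous_comp R3 R R (fun x : R3 => x ord0 i1 / psi (x ord0 i0)) (@clamp R) x);
    last exact: clamp_continuous.
  apply: (@continuousM R R3 (fun x : R3 => x ord0 i1)
    (fun x : R3 => (psi (x ord0 i0))^-1) x); first exact: coordinate_continuous.
  have n0 : psi (x ord0 i0) != 0 by rewrite gt_eqF.
  have cp : {for x, continuous (fun x : R3 => psi (x ord0 i0))}.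
    exact: comp_coordinate_continuous.
  exact: (@continuousV R R3 _ x n0 cp).
have pE : psi (x ord0 i0) = 0 by apply/eqP; rewrite eq_le p_le0 psi0.
have cE : chi (x ord0 i0) = 0.
  by apply/eqP; rewrite eq_le chi0 andbT leNgt -psichi -leNgt.
have D0 : stretch_height x = 0 by rewrite /stretch_height pE cE subrr mul0r.
apply/(@cvgrPdist_lt R R R3 (nbhs x) (nbhs_filter x)) => e e0; rewrite D0.
have : nbhs x [set y : R3 | `|0 - (chi (y ord0 i0) - psi (y ord0 i0))| < e].
  have /(@cvgrPdist_lt R R R3 (nbhs x) (nbhs_filter x))/(_ e e0) := cd x.
  by rewrite pE cE subrr.
apply: filterS => y /=; rewrite !sub0r !normrN /stretch_height normrM.
apply: le_lt_trans; rewrite ler_piMr //.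
by have := clamp_itv (y ord0 i1 / psi (y ord0 i0)) => /andP[k0 k1]; rewrite ger0_norm.
Qed.

End Stretch.

Lemma stretch_cancel (psi chi : R -> R) : (forall s, 0 <= psi s) ->
  (forall s, 0 <= chi s) -> (forall s, (0 < psi s) = (0 < chi s)) ->
  cancel (push e2 (stretch_height psi chi)) (push e2 (stretch_height chi psi)).
Proof.
move=> psi0 chi0 pc x.
set y := push _ _ x; have [y0 y1 y2] := addZ_e2 x (stretch_height psi chi x).
rewrite -/(push _ _ x) -/y in y0 y1 y2.
have [z0 z1 z2] := addZ_e2 y (stretch_height chi psi y).
rewrite -/(push _ _ y) in z0 z1 z2.
apply: row3P; rewrite ?z0 ?z2 // z1 /stretch_height y0 y1.
exact: (@stretchK (psi (x ord0 i0)) (chi (x ord0 i0)) (x ord0 i1)).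
Qed.

(** At time [t] the partial push is the full stretch from [psi] to the interpolation [xi], which is
    positive where [psi] is, hence again a homeomorphism. *)
Lemma stretch_isotopic (psi chi : R -> R) : continuous psi -> continuous chi ->
  (forall s, 0 <= psi s) -> (forall s, 0 <= chi s) ->
  (forall s, (0 < psi s) = (0 < chi s)) ->
  isotopic_to_id (push e2 (stretch_height psi chi)).
Proof.
move=> cpsi cchi psi0 chi0 pc; apply: isotopic_to_id_push.
  exact: stretch_height_continuous.
move=> t t01.
pose xi s := (1 - t) * psi s + t * chi s.
have cxi : continuous xi.
  move=> s; apply: (@continuousD R R R (fun s => (1 - t) * psi s)
    (fun s => t * chi s) s).
    exact: (@continuousM R R (cst (1 - t)) psi s (cvg_cst _) (cpsi s)).
  exact: (@continuousM R R (cst t) chi s (cvg_cst _) (cchi s)).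
have xi0 s : 0 <= xi s.
  by rewrite addr_ge0 // mulr_ge0 ?psi0 ?chi0 //; lra.
have xipos s : (0 < psi s) = (0 < xi s).
  apply/idP/idP => [p0|].
    by have c0 : 0 < chi s; [rewrite -pc|rewrite /xi; nra].
  rewrite !lt_neqAle !psi0 xi0 !andbT !(eq_sym 0); apply: contraNneq => p0.
  have c0 : chi s = 0 by apply/eqP; rewrite eq_le chi0 andbT leNgt -pc p0 ltxx.
  by rewrite /xi p0 c0 !mulr0 addr0.
have -> : (fun x => x + (t * stretch_height psi chi x) *: e2) =
    push e2 (stretch_height psi xi).
  apply/funext => x; rewrite /push /stretch_height /xi; congr (_ + _ *: _); ring.
split.
  apply: push_continuous; exact: stretch_height_continuous.
exists (push e2 (stretch_height xi psi)).
  by apply: push_continuous; exact: stretch_height_continuous.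
by split; exact: stretch_cancel.
Qed.

Lemma vertical_push_isotopic (k : R -> R) : continuous k ->
  isotopic_to_id (push e2 (fun x => k (x ord0 i0))).
Proof.
move=> ck; have cc : continuous (fun x : R3 => k (x ord0 i0)).
  exact: comp_coordinate_continuous.
apply: isotopic_to_id_push => // t _.
have ct (r : R) : continuous (push e2 (fun x => r * k (x ord0 i0))).
  apply: push_continuous => x.
  apply: (@continuousM R R3 (cst r) (fun x : R3 => k (x ord0 i0)) x).
    exact: cst_continuous.
  exact: cc.
split; first exact: ct.
exists (push e2 (fun x => - t * k (x ord0 i0))); first exact: ct.
split=> x; rewrite /push.
  have [-> _ _] := addZ_e2 x (t * k (x ord0 i0)).
  by rewrite mulNr scaleNr addrK.
have [-> _ _] := addZ_e2 x (- t * k (x ord0 i0)).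
by rewrite mulNr scaleNr subrK.
Qed.

(** The upper side is stretched to twice the height of the unit semicircle, then everything is
    lowered by that height: the two sides become the two semicircles. These maps need not be
    piecewise linear, as [trivial_knot] is topological. *)
Lemma planar_bigon_trivial (psi : R -> R) : continuous psi ->
  psi (-1) = 0 -> psi 1 = 0 -> (forall s, -1 < s < 1 -> 0 < psi s) ->
  trivial_knot [set x : R3 | -1 <= x ord0 i0 <= 1 /\ x ord0 i2 = 0 /\
    (x ord0 i1 = 0 \/ x ord0 i1 = psi (x ord0 i0))].
Proof.
move=> cpsi psiN1 psi1 psi_gt0.
(* Nothing is known of [psi] outside [[-1, 1]]; composed with this retraction it becomes positive
   exactly on the open interval. *)
pose cl (s : R) := 2 * clamp ((s + 1) / 2) - 1.
have ccl : continuous cl.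
  move=> s; apply: (@continuousB R R R (fun s => 2 * clamp ((s + 1) / 2)) (cst 1) s);
    last exact: cst_continuous.
  apply: (@continuousM R R (cst 2) (fun s => clamp ((s + 1) / 2)) s).
    exact: cst_continuous.
  apply: (@continuous_comp R R R (fun s => (s + 1) / 2) (@clamp R) s);
    last exact: clamp_continuous.
  apply: (@continuousM R R (fun s => s + 1) (cst 2^-1) s);
    last exact: cst_continuous.
  by apply: (@continuousD R R R id (cst 1) s); [exact: cvg_id|exact: cst_continuous].
have clE s : -1 <= s <= 1 -> cl s = s by move=> s1; rewrite /cl clampE; lra.
have cl1 s : -1 <= cl s <= 1.
  by rewrite /cl; have := clamp_itv ((s + 1) / 2); lra.
have psi_ge0 s : -1 <= s <= 1 -> 0 <= psi s.
  move=> s1; have [->|sN1] := eqVneq s (-1); first by rewrite psiN1.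
  have [->|sn1] := eqVneq s 1; first by rewrite psi1.
  by apply/ltW/psi_gt0; rewrite !lt_neqAle (eq_sym _ s) sN1 sn1.
pose p s := psi (cl s).
have cp : continuous p.
  by move=> s; apply: (@continuous_comp R R R cl psi s); [exact: ccl|exact: cpsi].
have p0 s : 0 <= p s by exact/psi_ge0/cl1.
(* [Num.sqrt] is 0 on negative numbers, so [rt] too is positive exactly on the open interval, which
   makes [p] and [q] comparable. *)
pose rt (s : R) := Num.sqrt (1 - s ^+ 2).
have crt : continuous rt.
  move=> s; apply: (@continuous_comp R R R (fun s => 1 - s ^+ 2) (@Num.sqrt R) s);
    last exact: sqrt_continuous.
  apply: (@continuousB R R R (cst 1) (fun s => s ^+ 2) s); first exact: cst_continuous.
  exact: exprn_continuous.
pose q s := 2 * rt s.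
have cq : continuous q.
  move=> s; exact: (@continuousM R R (cst 2) rt s (cvg_cst _) (crt s)).
have q0 s : 0 <= q s by rewrite mulr_ge0 ?sqrtr_ge0.
have pq s : (0 < p s) = (0 < q s).
  rewrite pmulr_rgt0 // sqrtr_gt0.
  have [s1|s1] := boolP (-1 < s < 1).
    by rewrite /p clE ?psi_gt0 //; [apply/esym; nra|lra].
  have -> : (0 < 1 - s ^+ 2) = false.
    by apply/negP => s2; move/negP: s1; apply; apply/andP; split; nra.
  have clp : clamp ((s + 1) / 2) = 0 \/ clamp ((s + 1) / 2) = 1.
    rewrite /clamp; have [sN|sN] := leP s (-1).
      by left; apply/max_idPl; rewrite ge_min; apply/orP; right; lra.
    have s11 : 1 <= s by rewrite leNgt; apply: contra s1 => ->; rewrite sN.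
    right; rewrite (min_idPl _) ?(max_idPr ler01) //; lra.
  rewrite /p /cl; case: clp => ->.
    by rewrite mulr0 sub0r psiN1 ltxx.
  by rewrite mulr1 (_ : 2 - 1 = 1 :> R) ?psi1 ?ltxx //; lra.
pose M := push e2 (stretch_height p q).
have M0 x : x ord0 i1 = 0 -> M x = x.
  move=> x1; rewrite /M /push /stretch_height x1 mul0r clampE ?lexx ?ler01 //.
  by rewrite mulr0 scale0r addr0.
have Mp x : x ord0 i1 = p (x ord0 i0) ->
    M x = x + (q (x ord0 i0) - p (x ord0 i0)) *: e2.
  move=> x1; rewrite /M /push /stretch_height x1; congr (_ + _ *: _).
  have [ppos|pneg] := ltP 0 (p (x ord0 i0)).
    by rewrite divff ?gt_eqF // clampE ?ler01 ?lexx ?mulr1.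
  have pE : p (x ord0 i0) = 0 by apply/eqP; rewrite eq_le pneg p0.
  have qE : q (x ord0 i0) = 0.
    by apply/eqP; rewrite eq_le q0 andbT leNgt -pq pE ltxx.
  by rewrite pE qE subrr mul0r.
pose N := push e2 (fun x => - rt (x ord0 i0)).
have hN : isotopic_to_id N.
  apply: (@vertical_push_isotopic (fun s => - rt s)) => s.
  exact: (continuousN (crt s)).
have hM : isotopic_to_id M by exact: stretch_isotopic.
have rt2 s : -1 <= s <= 1 -> s ^+ 2 + rt s ^+ 2 = 1.
  by move=> s1; rewrite sqr_sqrtr; [rewrite addrC subrK|nra].
have [H aH H1] := isotopic_to_id_comp hN hM.
exists H => //; rewrite H1 /standard_circle.
apply/seteqP; split=> [y [x [x0 [x2 x1]] <-] /=|y /= [y01 y2]].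
  have [n0 n1 n2] := addZ_e2 (M x) (- rt (M x ord0 i0)).
  rewrite -[M x + _]/(N (M x)) in n0 n1 n2; rewrite n0 n1 n2.
  case: x1 => x1.
    by rewrite M0 // x1 add0r sqrrN x2 rt2.
  have px1 : x ord0 i1 = p (x ord0 i0) by rewrite /p clE.
  rewrite Mp //; have [-> -> ->] := addZ_e2 x (q (x ord0 i0) - p (x ord0 i0)).
  rewrite px1 x2; split=> //.
  rewrite (_ : p _ + _ + _ = rt (x ord0 i0)); first exact: rt2.
  by rewrite /q; ring.
have y0 : -1 <= y ord0 i0 <= 1 by apply/andP; split; nra.
have ry : rt (y ord0 i0) = `|y ord0 i1|.
  by rewrite /rt (_ : 1 - _ = y ord0 i1 ^+ 2) ?sqrtr_sqr //; lra.
have [yneg|ypos] := leP (y ord0 i1) 0.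
  have [x0 x1 x2] := addZ_e2 y (- y ord0 i1); rewrite subrr in x1.
  exists (y + (- y ord0 i1) *: e2); first by rewrite x0 x1 x2; split=> //; split=> //; left.
  rewrite /= M0 // /N /push x0 ry ler0_norm // opprK -addrA -scalerDl.
  by rewrite addrC addNr scale0r add0r.
have [x0 x1 x2] := addZ_e2 y (p (y ord0 i0) - y ord0 i1).
rewrite [RHS]addrC subrK in x1.
exists (y + (p (y ord0 i0) - y ord0 i1) *: e2).
  by rewrite x0 x1 x2; split=> //; split=> //; right; rewrite /p clE.
rewrite /= Mp; last by rewrite x0 x1.
rewrite x0 -addrA -scalerDl /N /push.
have [-> _ _] := addZ_e2 y (p (y ord0 i0) - y ord0 i1 + (q (y ord0 i0) - p (y ord0 i0))).
rewrite -addrA -scalerDl /q ry gtr0_norm //.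
by rewrite [X in X *: e2](_ : _ = 0) ?scale0r ?addr0 //; ring.
Qed.

(* In coordinates where the arc is a segment of the first axis, the copy is the
   graph of a function over it. *)
Lemma double_arc (gam : R -> R3) Z : pl_arc gam -> polygonal Z ->
  Z (gam 0) -> Z (gam 1) -> (forall t, 0 < t < 1 -> ~ Z (gam t)) ->
  exists h, [/\ plhomeo h, forall x, Z x -> h x = x,
    forall x, (gam @` `[0, 1]) x -> ~ Z x -> ~ (gam @` `[0, 1]) (h x) &
    trivial_knot ((gam @` `[0, 1]) `|` h @` (gam @` `[0, 1]))].
Proof.
move=> ag pZ Z0 Z1 Zt; set B := gam @` _.
have [g0 hg0 g0B] := straightenable1 ag.
have [_ ig _] := ag.
have neq : g0 (gam 0) != g0 (gam 1).
  by apply/eqP => /(plhomeo_inj hg0)/ig; lra.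
have [g1 [sg [hg1 g1a g1b g1I]]] := normalise_segment neq.
pose g := g1 \o g0.
have hg : plhomeo g by exact: plhomeo_comp.
have gB : g @` B = segment (- e1) e1 by rewrite -g1I -g0B image_comp.
have [rho [prho rho0 rhoZ]] : pl_closed (g @` Z).
  exact/polygonal_pl_closed/polygonal_plhomeo.
have [e e_gt0 pe] := pl_small e2 prho.
pose f x := e * rho x.
have fZ x : Z x -> f (g x) = 0.
  by move=> Zx; rewrite /f (rhoZ _).2 ?mulr0 //; exists x.
have f0 x : ~ Z x -> 0 < f (g x).
  move=> nZ; rewrite mulr_gt0 // lt_neqAle rho0 andbT eq_sym.
  by apply/eqP => /rhoZ[y Zy /(plhomeo_inj hg) yx]; apply: nZ; rewrite -yx.
have [k hk [gK kK]] := plhomeo_inverse hg.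
pose h := k \o (push e2 f \o g).
have hh : plhomeo h.
  by apply: plhomeo_comp => //; apply: plhomeo_comp => //; exact: plhomeo_of_push.
have gh x : g (h x) = push e2 f (g x) by rewrite /h /= kK.
have Bg x : B x -> segment (- e1) e1 (g x) by rewrite -gB => Bx; exists x.
exists h; split => //.
- by move=> x Zx; rewrite /h /= /push fZ // scale0r addr0 gK.
- move=> x Bx nZ Bhx; have := f0 x nZ.
  have := Bg _ Bhx; have := Bg _ Bx; rewrite gh segment_e1 /= => -[_ x1 _] [_ + _].
  by have [_ -> _] := addZ_e2 (g x) (f (g x)); rewrite x1; lra.
apply/(trivial_knot_homeo _ (plhomeo_isotopic hg)).
rewrite image_setU (_ : g @` (h @` B) = push e2 f @` segment (- e1) e1); last first.
  by rewrite -gB !image_comp; congr (_ @` _); apply/funext => x /=; rewrite -gh.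
rewrite gB.
pose psi s := f (s *: e1).
have yE y : segment (- e1) e1 y -> y = y ord0 i0 *: e1.
  rewrite segment_e1 => -[_ y1 y2]; apply: row3P; rewrite !mxE !inord_eq //= ?y1 ?y2.
  - by rewrite mulr1.
  - by rewrite mulr0.
  - by rewrite mulr0.
have gends : f (- e1) = 0 /\ f e1 = 0.
  have := fZ _ Z0; have := fZ _ Z1; rewrite /g /= g1a g1b.
  by case: (sg); rewrite ?expr1 ?expr0 ?scale1r // !scaleN1r opprK.
have -> : segment (- e1) e1 `|` push e2 f @` segment (- e1) e1 =
    [set x : R3 | -1 <= x ord0 i0 <= 1 /\ x ord0 i2 = 0 /\
      (x ord0 i1 = 0 \/ x ord0 i1 = psi (x ord0 i0))].
  apply/seteqP; split=> y.
    case=> [|[x xI <-]]; first by rewrite segment_e1 => -[y0 y1 y2]; split=> //; split=> //; left.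
    have [n0 n1 n2] := addZ_e2 x (f x); rewrite -[x + _]/(push e2 f x) in n0 n1 n2.
    have xE := yE x xI; move: xI; rewrite segment_e1 => -[x0 x1 x2].
    rewrite /= n0 n1 n2; split=> //; split=> //; right.
    by rewrite x1 add0r /psi -xE.
  move=> [y0 [y2 [y1|y1]]]; first by left; rewrite segment_e1.
  right; exists (y ord0 i0 *: e1).
    rewrite segment_e1 /= !mxE !inord_eq //=.
    by rewrite !mulr0 mulr1.
  have [n0 n1 n2] := addZ_e2 (y ord0 i0 *: e1) (f (y ord0 i0 *: e1)).
  rewrite -[_ + _]/(push e2 f _) in n0 n1 n2.
  apply: row3P; rewrite ?n0 ?n1 ?n2 !mxE !inord_eq //=.
  - by rewrite mulr1.
  - by rewrite mulr0 add0r y1.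
  - by rewrite mulr0 y2.
apply: planar_bigon_trivial.
- move=> s; apply: (@continuous_comp R R3 R (fun s => s *: e1) f s).
    exact: scalel_continuous.
  exact/pl_continuous/plu_pl/pe.
- by rewrite /psi scaleN1r gends.1.
- by rewrite /psi scale1r gends.2.
move=> s s1; have : segment (- e1) e1 (s *: e1).
  rewrite segment_e1 /= !mxE !inord_eq //=.
  by rewrite !mulr0 mulr1; split=> //; lra.
rewrite -gB => -[x [t /=]]; rewrite in_itv /= => t01 <- sE.
rewrite /psi -sE; apply/f0/Zt.
(* The point is neither end of the segment, so its parameter on the arc is neither 0 nor 1 and it
   avoids [Z]. *)
have e1s (b : bool) : s *: e1 != (-1) ^+ b *: e1.
  rewrite -subr_eq0 -scalerBl scaler_eq0 (negbTE e1_neq0) orbF subr_eq0.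
  by case: b; rewrite ?expr1 ?expr0; apply/eqP; lra.
have t0 : t != 0.
  apply: contraNneq (e1s (~~ sg)) => t0; rewrite -sE t0 /g /= g1a scalerN.
  by case: (sg); rewrite /= ?expr1 ?expr0 ?scale1r ?scaleN1r ?opprK.
have t1 : t != 1.
  by apply: contraNneq (e1s sg) => t1; rewrite -sE t1 /g /= g1b.
by rewrite !lt_neqAle eq_sym t0 t1.
Qed.

End PlanarBigon.

(** * Disjoint copies of all edges *)

Section Doubling.
Variables (R : realType) (G : graph).
Local Notation R3 := 'rV[R]_3.
Implicit Types (e : edge G) (x y : R3) (t : R).

Section PolygonalEmbedding.
Variable f : embedding R G.
Hypothesis polyf : forall e, polygonal (edge_image f e).

Local Notation E := (edge_image f).

Definition vertices : set R3 := range (pos f).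

Lemma edge_image_clamp e : E e = (edge_path f e \o @clamp R) @` `[0, 1].
Proof.
apply/seteqP; split=> y [t /=]; rewrite in_itv /= => t01 <-;
  by exists t; rewrite /= ?in_itv //= clampE.
Qed.

Lemma edge_imageP e x : E e x -> vertices x \/
  exists2 t, 0 < t < 1 & x = edge_path f e t.
Proof.
move=> [t /=]; rewrite in_itv /= => t01 <-.
have [->|t0] := eqVneq t 0; first by left; rewrite edge_path0; exists (ends e).1.
have [->|t1] := eqVneq t 1; first by left; rewrite edge_path1; exists (ends e).2.
by right; exists t; rewrite // !lt_neqAle eq_sym t0 t1.
Qed.

Lemma interior_not_vertex e t : 0 < t < 1 -> ~ vertices (edge_path f e t).
Proof. by move=> t01 [v _ /esym]; exact: edge_path_pos. Qed.

Lemma interior_not_edge e e' t : 0 < t < 1 -> E e' (edge_path f e t) -> e = e'.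
Proof.
move=> t01 /edge_imageP[/(interior_not_vertex t01) //|[t' t'01]].
by move=> /(edge_path_inj t01 t'01)[].
Qed.

Lemma edge_nonvertex e x : E e x -> ~ vertices x ->
  exists2 t, 0 < t < 1 & x = edge_path f e t.
Proof. by move=> /edge_imageP[]. Qed.

Lemma edge_pl_arc e : (ends e).1 != (ends e).2 ->
  pl_arc (edge_path f e \o @clamp R).
Proof.
move=> ne; split; last by rewrite -edge_image_clamp.
  exact/within_clamp/edge_path_continuous.
have sym s t : 0 <= s <= 1 -> 0 <= t <= 1 -> s < t ->
    edge_path f e s <> edge_path f e t.
  move=> s01 t01 st.
  have [->|s0] := eqVneq s 0.
    have [->|t1] := eqVneq t 1.
      by rewrite edge_path0 edge_path1 => /pos_inj/eqP; rewrite (negbTE ne).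
    rewrite edge_path0 => /esym; apply: edge_path_pos.
    by apply/andP; split; [lra|rewrite lt_neqAle t1; lra].
  have hs : 0 < s < 1 by apply/andP; split; [rewrite lt_neqAle eq_sym s0; lra|lra].
  have [->|t1] := eqVneq t 1; first by rewrite edge_path1; exact: edge_path_pos.
  have ht : 0 < t < 1 by apply/andP; split; [lra|rewrite lt_neqAle t1; lra].
  by move=> /(edge_path_inj hs ht)[_]; lra.
move=> s t s01 t01 /=; rewrite !clampE // => est.
by have [/(sym _ _ s01 t01)|/(sym _ _ t01 s01)|] := ltgtP s t; rewrite ?est.
Qed.

(** A loop cannot be straightened, but only disjointness is asked of its copy, which [push_off]
    provides. *)
Lemma edge_double e Z : polygonal Z -> vertices `<=` Z ->
  (forall t, 0 < t < 1 -> ~ Z (edge_path f e t)) ->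
  exists h, [/\ plhomeo h, forall x, Z x -> h x = x,
    forall x, E e x -> ~ Z x -> ~ E e (h x) &
    (ends e).1 <> (ends e).2 -> trivial_knot (E e `|` h @` E e)].
Proof.
move=> pZ VZ Zt; have [loop|/eqP ne] := pselect ((ends e).1 = (ends e).2).
  have [h [hh hZ hE]] := push_off pZ (polyf e).
  by exists h; split.
have [||t t01|h [hh hZ hE hK]] := double_arc (edge_pl_arc ne) pZ.
- by rewrite /= clampE ?lexx ?ler01 // edge_path0; apply: VZ; exists (ends e).1.
- by rewrite /= clampE ?lexx ?ler01 // edge_path1; apply: VZ; exists (ends e).2.
- by rewrite /= clampE; [exact: Zt|lra].
by rewrite -edge_image_clamp in hE hK; exists h; split.
Qed.

(** [s] lists the edges treated so far. Copies must avoid every edge of the graph, treated or not,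
    so that the remaining copies can still be made; [copy_isotopy] replaces any subset of treated
    edges at once. *)
Record parallel_copies (s : seq (edge G)) (h : edge G -> R3 -> R3) : Prop :=
  ParallelCopies {
  copy_plhomeo : forall e, plhomeo (h e);
  copy_vertex : forall e v, h e (pos f v) = pos f v;
  copy_edge_disjoint : forall e e' x, e \in s -> E e x -> ~ vertices x ->
    ~ E e' (h e x);
  copy_copy_disjoint : forall e e' x y, e \in s -> e' \in s -> e != e' ->
    E e x -> ~ vertices x -> E e' y -> h e x <> h e' y;
  copy_bigon : forall e, e \in s -> (ends e).1 <> (ends e).2 ->
    trivial_knot (E e `|` h e @` E e);
  copy_isotopy : forall S : {set edge G}, {subset S <= s} -> exists2 H,
    isotopic_to_id H & forall e x, E e x -> H x = if e \in S then h e x else x }.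

Lemma parallel_copies_nil : parallel_copies [::] (fun=> id).
Proof.
split=> // [_|S S0]; first exact: plhomeo_id.
exists id; first exact: isotopic_to_id_id.
by move=> e x _; case: ifP => // /S0.
Qed.

(** The new copy is made relative to [Z]: the vertices, all other edges and the existing copies. The
    interior of [e] avoids [Z] because existing copies avoid all edges. *)
Lemma parallel_copies_cons s e h : e \notin s -> parallel_copies s h ->
  exists h', parallel_copies (e :: s) h'.
Proof.
move=> es [hpl hv hE hh hbi hiso].
pose Z := vertices `|` (\bigcup_(e' in [set` rem e (enum (edge G))]) E e' `|`
  \bigcup_(e' in [set` s]) h e' @` E e').
have remP e' : (e' \in rem e (enum (edge G))) = (e' != e).
  by rewrite mem_rem_uniq ?enum_uniq // !inE mem_enum andbT.
have pZ : polygonal Z.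
  apply: polygonalU.
    rewrite (_ : vertices = \bigcup_(v in [set` enum (vertex G)]) [set pos f v]).
      by apply: polygonal_bigcup => v _; exact: polygonal1.
    apply/seteqP; split=> x [v]; first by move=> _ <-; exists v => //=; rewrite mem_enum.
    by move=> _ ->; exists v.
  apply: polygonalU; apply: polygonal_bigcup => e' _; first exact: polyf.
  exact: polygonal_plhomeo.
have ZE e' x : e' != e -> E e' x -> Z x.
  by move=> ne Ex; right; left; exists e' => //=; rewrite remP.
have Zh e' x : e' \in s -> E e' x -> Z (h e' x).
  by move=> e's Ex; right; right; exists e' => //; exists x.
have Zt t : 0 < t < 1 -> ~ Z (edge_path f e t).
  move=> t01 [|[]]; first exact: interior_not_vertex.
    move=> [e' /=]; rewrite remP => ne /(interior_not_edge t01) ee'.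
    by rewrite ee' eqxx in ne.
  move=> [e' /= e's [x Ex hx]].
  have [Vx|nVx] := pselect (vertices x).
    apply: (interior_not_vertex (e := e) t01); rewrite -hx.
    by case: Vx => v _ <-; rewrite hv; exists v.
  apply: (hE e' e x e's Ex nVx); rewrite hx.
  by exists t => //=; rewrite in_itv /=; lra.
have VZ : vertices `<=` Z by move=> x; left.
have [h0 [h0pl h0Z h0E h0bi]] := edge_double pZ VZ Zt.
(* If [h0 x] lay in [Z] it would be fixed by [h0]; injectivity gives [h0 x = x], so [x] itself would
   lie in [Z]. *)
have nZ x : E e x -> ~ vertices x -> ~ Z (h0 x).
  move=> Ex nVx Zhx; have /(plhomeo_inj h0pl) hx := h0Z _ Zhx.
  have [t t01 xt] := edge_nonvertex Ex nVx.
  by apply: (Zt t t01); rewrite -xt -hx.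
pose h' e' := if e' == e then h0 else h e'.
have h'e : h' e = h0 by rewrite /h' eqxx.
have h's e' : e' \in s -> h' e' = h e'.
  by move=> e's; rewrite /h'; case: eqP => // ee'; rewrite -ee' e's in es.
exists h'; split.
- by move=> e'; rewrite /h'; case: ifP.
- by move=> e' v; rewrite /h'; case: ifP => // _; apply/h0Z/VZ; exists v.
- move=> e' e'' x; rewrite inE => /orP[/eqP ->|e's] Ex nVx; last first.
    by rewrite h's //; exact: hE.
  rewrite h'e => Ehx; have [ee|ne] := eqVneq e'' e.
    have [t t01 xt] := edge_nonvertex Ex nVx.
    apply: (h0E x Ex); first by rewrite xt; exact: Zt.
    by rewrite -[X in E X]ee.
  exact: nZ Ex nVx (ZE _ _ ne Ehx).
- move=> e' e'' x y; rewrite !inE => /orP[/eqP ->|e's] /orP[/eqP ->|e''s] ne Ex nVx Ey.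
  + by rewrite eqxx in ne.
  + by rewrite h'e h's // => hxy; apply: nZ Ex nVx _; rewrite hxy; exact: Zh.
  + rewrite h'e h's // => hxy; have [Vy|nVy] := pselect (vertices y).
      apply: nVx; case: Vy hxy => v _ <-; rewrite h0Z; last by apply: VZ; exists v.
      by rewrite -(hv e' v) => /(plhomeo_inj (hpl e')) ->; exists v.
    by apply: nZ Ey nVy _; rewrite -hxy; exact: Zh.
  + by rewrite !h's //; exact: hh.
- move=> e'; rewrite inE => /orP[/eqP ->|e's]; first by rewrite h'e.
  by rewrite h's //; exact: hbi.
move=> S Ss; have [eS|eS] := boolP (e \in S); last first.
  have [|H Hi HE] := hiso S.
    by move=> e' e'S; have := Ss _ e'S; rewrite inE => /orP[/eqP ee'|//];
      rewrite -ee' e'S in eS.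
  exists H => // e' x Ex; rewrite (HE _ _ Ex); case: ifP => // e'S.
  by rewrite /h'; case: eqP => // ee'; rewrite -ee' e'S in eS.
have [|H Hi HE] := hiso (S :\ e).
  by move=> e'; rewrite !inE => /andP[ne /Ss]; rewrite inE (negbTE ne).
(* [H] does not move [e] and takes the other edges into [Z], so applying [h0] last affects [e]
   alone. *)
exists (h0 \o H); first exact: isotopic_to_id_comp (plhomeo_isotopic h0pl) Hi.
move=> e' x Ex /=; rewrite (HE _ _ Ex) !inE.
have [ee'|ne] := eqVneq e' e; first by rewrite ee' eS h'e.
have [e'S|e'S] /= := boolP (e' \in S); last by apply: h0Z; exact: ZE Ex.
have e's : e' \in s by have := Ss _ e'S; rewrite inE (negbTE ne).
by rewrite h's // h0Z //; exact: Zh.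
Qed.

Lemma parallel_copies_all : exists h, parallel_copies (enum (edge G)) h.
Proof.
have : uniq (enum (edge G)) by exact: enum_uniq.
elim: (enum _) => [|e s IH] /=; first by exists (fun=> id); exact: parallel_copies_nil.
by move=> /andP[es /IH[h]]; exact: parallel_copies_cons.
Qed.

End PolygonalEmbedding.
End Doubling.

(** * Directed cycles of the symmetric digraph *)

Section DirectedCycles.
Variable G : graph.
Local Notation D := (symmetric_digraph G).
Implicit Types (C : {set darc D}) (e : edge G).

Lemma ordSE n (i : 'I_n.+1) : ordS i = (i.+1 %% n.+1)%N :> nat.
Proof. by []. Qed.

Lemma ordS_involution n (i j : 'I_n.+1) : i != j -> ordS i = j -> ordS j = i ->
  forall k, (k == i) || (k == j).
Proof.
move=> ij ei ej; have n1 : n = 1%N.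
  move/(congr1 val): ei; move/(congr1 val): ej; rewrite /= => ej ei.
  have {}ij : (i : nat) != j by [].
  have := ltn_ord i; have := ltn_ord j; rewrite !ltnS => jn iN.
  have [lt_in|ge_in] := ltnP i n.
    rewrite modn_small ?ltnS // in ei.
    have [lt_jn|ge_jn] := ltnP j n; first by rewrite modn_small ?ltnS // in ej; lia.
    have ejn : (j : nat) = n by lia.
    by rewrite ejn modnn in ej; lia.
  have ein : (i : nat) = n by lia.
  rewrite ein modnn in ei.
  have n0 : (0 < n)%N by lia.
  by rewrite -ei modn_small in ej; lia.
move=> k; rewrite -!val_eqE /=; have := ltn_ord i; have := ltn_ord j.
have := ltn_ord k; move: ij; rewrite -val_eqE /=; lia.
Qed.

Lemma ordS_orbit n (P : 'I_n.+1 -> Prop) i : P i ->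
  (forall j, P j -> P (ordS j)) -> forall j, P j.
Proof.
move=> Pi PS j.
have iterE k : (iter k (@ordS n.+1) i : nat) = ((i + k) %% n.+1)%N.
  elim: k => [|k IH]; first by rewrite addn0 modn_small.
  by rewrite iterS ordSE IH addnS -addn1 modnDml addn1.
suff <- : iter (j + (n.+1 - i)) (@ordS n.+1) i = j.
  by elim: (_ + _)%N => // k; rewrite iterS; exact: PS.
apply/val_inj; rewrite /= iterE.
have -> : (i + (j + (n.+1 - i)) = j + n.+1)%N by have := ltn_ord i; lia.
by rewrite modnDr modn_small.
Qed.

Lemma opposite_arc (a b : darc D) : a.1 = b.1 -> a <> b ->
  source a = target b /\ target a = source b.
Proof. by case: a b => [e []] [e' []] /= ->. Qed.

(** If both arcs over one edge occur, distinctness of the vertices makes each the successor of the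
    other, so the length is 2. Otherwise forgetting directions is injective on the arcs. *)
Lemma directed_cycle_cases C : is_directed_cycle C ->
  (exists2 e, (ends e).1 <> (ends e).2 & C = [set (e, true); (e, false)]%SET) \/
  is_cycle (fst @: C) /\ {in C &, injective fst}.
Proof.
move=> [n [v [a [v_inj a_inj va CE]]]].
have [[i [j [ij aij]]]|noij] := pselect (exists i j, i != j /\ (a i).1 = (a j).1).
  left; have aneq : a i <> a j by move=> /a_inj/eqP; rewrite (negbTE ij).
  have [st ts] := opposite_arc aij aneq.
  have [si ti] := va i; have [sj tj] := va j.
  have Si : ordS i = j by apply: v_inj; rewrite -ti ts sj.
  have Sj : ordS j = i by apply: v_inj; rewrite -tj -st si.
  have all_ij := ordS_involution ij Si Sj.
  have {}CE : C = [set a i; a j]%SET.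
    rewrite CE; apply/setP => x; rewrite !inE; apply/imsetP/idP => [[k _ ->]|].
      by have /orP[/eqP ->|/eqP ->] := all_ij k; rewrite eqxx ?orbT.
    by case/orP => /eqP ->; [exists i|exists j].
  exists (a i).1.
    move: (si) (ti); rewrite Si /=; case: ifP => _ -> -> /v_inj/eqP.
      by rewrite (negbTE ij).
    by rewrite eq_sym (negbTE ij).
  rewrite CE; move: aij aneq; case: (a i) (a j) => [e []] [e' []] /= -> //.
  by move=> _; rewrite finset.setUC.
right; have inj1 i j : (a i).1 = (a j).1 -> i = j.
  move=> aij; apply/eqP; apply: contrapT => /negP ij; apply: noij.
  by exists i, j.
split; last first.
  move=> x y; rewrite CE => /imsetP[i _ ->] /imsetP[j _ ->].
  by move=> /inj1 ->.
exists n, v, (fun i => (a i).1); split => //.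
  move=> i; have [<- <-] := va i; rewrite /=.
  by case: (a i) => [e []] /=; [left|right]; case: (ends e).
by rewrite CE -imset_comp.
Qed.

(** Common arcs propagate along [C]. If the arc after a common one occurred reversed in [C'], the
    reversed arc would end where the common arc ends, hence equal it; then both successive arcs of
    [C] lie over one edge and coincide. *)
Lemma directed_cycle_sub C C' a0 : is_directed_cycle C -> is_directed_cycle C' ->
  {in C &, injective fst} -> fst @: C = fst @: C' -> a0 \in C -> a0 \in C' ->
  C \subset C'.
Proof.
move=> [n [v [a [v_inj a_inj va CE]]]] [n' [v' [a' [v'_inj a'_inj va' CE']]]].
move=> fst_inj CC' a0C a0C'.
have inC i : a i \in C by rewrite CE imset_f.
suff H : forall i, a i \in C' by apply/fintype.subsetP => x; rewrite CE => /imsetP[i _ ->].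
have [i0 ei0] : exists i0, a0 = a i0 by move: a0C; rewrite CE => /imsetP[i _ ->]; exists i.
apply: (@ordS_orbit n (fun i => a i \in C') i0); first by rewrite -ei0.
move=> i; rewrite [in X in X -> _]CE' => /imsetP[j _ aij].
have : (a (ordS i)).1 \in fst @: C' by rewrite -CC' imset_f.
move=> /imsetP[b bC' eb]; have [->//|/eqP neq] := eqVneq (a (ordS i)) b.
have [sb _] := opposite_arc eb neq.
move: bC'; rewrite CE' => /imsetP[k _ bE].
have kj : k = j.
  apply/(can_inj (@ordSK _))/v'_inj; rewrite -(va' k).2 -bE -sb (va _).1.
  by rewrite -(va i).2 aij (va' j).2.
have /fst_inj -> : (a (ordS i)).1 = (a i).1 by rewrite eb bE kj aij.
- by rewrite aij imset_f.
- exact: inC.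
- exact: inC.
Qed.

End DirectedCycles.

(** * Embedding the symmetric digraph and counting its knotted cycles *)

Section DoubledEmbedding.
Variables (R : realType) (G : graph).
Local Notation R3 := 'rV[R]_3.
Local Notation D := (symmetric_digraph G).

Section Push.
Variables (f : embedding R G) (k : R3 -> R3).
Hypotheses (ck : continuous k) (k_inj : injective k).

Lemma push_path_continuous e : {within `[0, 1], continuous (k \o edge_path f e)}.
Proof.
apply: within_continuous_comp; last exact: edge_path_continuous.
by move=> x _; exact: ck.
Qed.

Lemma push_path0 e : (k \o edge_path f e) 0 = (k \o pos f) (ends e).1.
Proof. by rewrite /= edge_path0. Qed.

Lemma push_path1 e : (k \o edge_path f e) 1 = (k \o pos f) (ends e).2.
Proof. by rewrite /= edge_path1. Qed.

Lemma push_path_inj e e' t t' : 0 < t < 1 -> 0 < t' < 1 ->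
  (k \o edge_path f e) t = (k \o edge_path f e') t' -> e = e' /\ t = t'.
Proof. by move=> t01 t'01 /k_inj; exact: edge_path_inj. Qed.

Lemma push_path_pos e t v : 0 < t < 1 -> (k \o edge_path f e) t <> (k \o pos f) v.
Proof. by move=> t01 /k_inj; exact: edge_path_pos. Qed.

Definition push_embedding : embedding R G :=
  Embedding push_path_continuous push_path0 push_path1
    (inj_comp k_inj (@pos_inj _ _ f)) push_path_inj push_path_pos.

Lemma push_edge_image e : edge_image push_embedding e = k @` edge_image f e.
Proof. by rewrite /edge_image image_comp. Qed.

Lemma push_cycle_image C : cycle_image push_embedding C = k @` cycle_image f C.
Proof.
rewrite /cycle_image image_bigcup; apply: eq_bigcupr => e _.
exact: push_edge_image.
Qed.

End Push.

Section Restrict.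
Variable g : embedding R (underlying D).

Lemma restrict_inj (e e' : edge G) t t' : 0 < t < 1 -> 0 < t' < 1 ->
  edge_path g (e, true) t = edge_path g (e', true) t' -> e = e' /\ t = t'.
Proof. by move=> t01 t'01 /(edge_path_inj t01 t'01)[[->] ->]. Qed.

Definition restrict_embedding : embedding R G :=
  @Embedding R G (pos g) (fun e => edge_path g (e, true))
    (fun e => @edge_path_continuous R (underlying D) g (e, true))
    (fun e => @edge_path0 R (underlying D) g (e, true))
    (fun e => @edge_path1 R (underlying D) g (e, true))
    (@pos_inj _ _ g) restrict_inj
    (fun e t v => @edge_path_pos R (underlying D) g (e, true) t v).

(** Guarantees that the digraph has no tame embedding when the graph has none. *)
Lemma restrict_tame : tame g -> tame restrict_embedding.
Proof. by move=> [H aH pH]; exists H => // e; exact: pH (e, true). Qed.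

End Restrict.

Variable f : embedding R G.
Hypothesis polyf : forall e, polygonal (edge_image f e).
Variable h : edge G -> R3 -> R3.
Hypothesis hP : parallel_copies f (enum (edge G)) h.

(** The arc [(e, false)] starts at the second end of [e], so the copy is traversed backwards. *)
Definition doubled_path (a : edge G * bool) (t : R) : R3 :=
  if a.2 then edge_path f a.1 t else h a.1 (edge_path f a.1 (1 - t)).

Lemma doubled_path_continuous a : {within `[0, 1], continuous (doubled_path a)}.
Proof.
case: a => e []; first exact: edge_path_continuous.
pose k t := h e ((edge_path f e \o @clamp R) (1 - t)).
have ck : continuous k.
  move=> t; apply: (@continuous_comp R R3 R3
    (fun t => (edge_path f e \o @clamp R) (1 - t)) (h e)).
    apply: (@continuous_comp R R R3 (fun t => 1 - t) (edge_path f e \o @clamp R)).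
      by apply: (@continuousB R R R (cst 1) id t); [exact: cst_continuous|exact: cvg_id].
    exact/within_clamp/edge_path_continuous.
  exact/plhomeo_continuous/copy_plhomeo/hP.
apply: (subspace_eq_continuous _ (continuous_subspaceT ck)) => t.
rewrite inE /= in_itv /= => t01; rewrite /from_subspace /k /doubled_path /= clampE //.
by lra.
Qed.

Lemma doubled_path0 (a : edge (underlying D)) :
  doubled_path a 0 = pos f (ends a).1.
Proof.
case: a => e []; rewrite /doubled_path /= ?edge_path0 //.
by rewrite subr0 edge_path1 (copy_vertex hP).
Qed.

Lemma doubled_path1 (a : edge (underlying D)) :
  doubled_path a 1 = pos f (ends a).2.
Proof.
case: a => e []; rewrite /doubled_path /= ?edge_path1 //.
by rewrite subrr edge_path0 (copy_vertex hP).
Qed.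

Lemma edge_image_path e t : 0 < t < 1 -> edge_image f e (edge_path f e t).
Proof. by move=> t01; exists t => //=; rewrite in_itv /=; lra. Qed.

Lemma copy_not_edge e e' t t' : 0 < t < 1 -> 0 < t' < 1 ->
  h e (edge_path f e t) <> edge_path f e' t'.
Proof.
move=> t01 t'01 eq; have := edge_image_path e' t'01; rewrite -eq.
apply: (copy_edge_disjoint hP); first by rewrite mem_enum.
  exact: edge_image_path.
exact: interior_not_vertex.
Qed.

Lemma doubled_path_inj (a a' : edge (underlying D)) t t' :
  0 < t < 1 -> 0 < t' < 1 -> doubled_path a t = doubled_path a' t' ->
  a = a' /\ t = t'.
Proof.
move=> t01 t'01.
have s01 : 0 < 1 - t < 1 by lra.
have s'01 : 0 < 1 - t' < 1 by lra.
case: a a' => e [] [e' []]; rewrite /doubled_path /=.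
- by move=> /(edge_path_inj t01 t'01)[-> ->].
- by move=> /esym/(copy_not_edge s'01 t01).
- by move=> /(copy_not_edge s01 t'01).
have [->|ne] := eqVneq e e'.
  move=> /(plhomeo_inj (copy_plhomeo hP e'))/(edge_path_inj s01 s'01)[_ tt'].
  by split=> //; lra.
move=> eq; exfalso; apply: (copy_copy_disjoint hP _ _ ne _ _ _ eq).
- by rewrite mem_enum.
- by rewrite mem_enum.
- exact: edge_image_path.
- exact: interior_not_vertex.
- exact: edge_image_path.
Qed.

Lemma doubled_path_pos (a : edge (underlying D)) t v : 0 < t < 1 ->
  doubled_path a t <> pos f v.
Proof.
move=> t01; case: a => e []; rewrite /doubled_path /=; first exact: edge_path_pos.
rewrite -(copy_vertex hP e v) => /(plhomeo_inj (copy_plhomeo hP e)).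
by apply: edge_path_pos; lra.
Qed.

Definition doubled : embedding R (underlying D) :=
  @Embedding R (underlying D) (pos f) doubled_path doubled_path_continuous
    doubled_path0 doubled_path1 (@pos_inj _ _ f) doubled_path_inj doubled_path_pos.

Lemma doubled_edge_image (a : edge (underlying D)) : edge_image doubled a =
  if a.2 then edge_image f a.1 else h a.1 @` edge_image f a.1.
Proof.
case: a => e [] //=; rewrite /edge_image /= /doubled_path /=.
rewrite -(image_comp (fun t => edge_path f e (1 - t)) (h e)) //.
by rewrite image_reverse subr0 subrr.
Qed.

Lemma doubled_tame : tame doubled.
Proof.
have [H aH H1] := @isotopic_to_id_id R; exists H => // a.
rewrite H1 image_id doubled_edge_image; case: a.2 => //.
exact/polygonal_plhomeo/polyf/copy_plhomeo/hP.
Qed.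

Lemma doubled_knotted (C : {set darc D}) : is_directed_cycle C ->
  @knotted R (underlying D) doubled C ->
  [/\ is_cycle (fst @: C), {in C &, injective fst} & knotted f (fst @: C)].
Proof.
move=> dC kC; have [[e ne CE]|[cC iC]] := directed_cycle_cases dC.
  exfalso; apply: kC.
  have -> : cycle_image doubled C = edge_image f e `|` h e @` edge_image f e.
    apply/seteqP; split=> x.
      move=> [a /=]; rewrite CE !inE => /orP[] /eqP ->; rewrite doubled_edge_image /=.
        by left.
      by right.
    case=> xe; [exists (e, true)|exists (e, false)];
      by rewrite /= ?doubled_edge_image // CE !inE eqxx ?orbT.
  by apply: (copy_bigon hP) ne; rewrite mem_enum.
split=> // tC; apply: kC.
(* The edges that the cycle follows along their copies. As no edge is used in both directions, the
   isotopy is consistent with the arcs marked [true]. *)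
have [|H Hi HE] := copy_isotopy hP (S := [set e | (e, false) \in C]%SET).
  by move=> e _; rewrite mem_enum.
suff -> : cycle_image doubled C = H @` cycle_image f (fst @: C).
  exact/(trivial_knot_homeo _ Hi).
have HE1 e x b : (e, b) \in C -> edge_image f e x ->
    H x = if b then x else h e x.
  move=> ebC Ex; rewrite (HE _ _ Ex) inE; case: b ebC => ebC; last by rewrite ebC.
  case: ifP => // efC.
  by have := iC _ _ ebC efC erefl.
apply/seteqP; split=> x.
  move=> [[e b] /= ebC]; rewrite doubled_edge_image /=.
  case: b ebC => ebC.
    move=> Ex; exists x; last by rewrite (HE1 _ _ _ ebC Ex).
    by exists e => //=; apply/imsetP; exists (e, true).
  move=> [y Ey <-]; exists y; last by rewrite (HE1 _ _ _ ebC Ey).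
  by exists e => //=; apply/imsetP; exists (e, false).
move=> [y [e /= /imsetP[[e' b] ebC /= ->] Ey] <-].
exists (e', b) => //; rewrite doubled_edge_image /= (HE1 _ _ _ ebC Ey).
by case: b ebC => // _; exists y.
Qed.

Lemma doubled_knot_count :
  (@directed_knot_count R D doubled <= 2 * knot_count f)%N.
Proof.
(* A directed cycle is determined by its edges and the direction of one edge. *)
pose F (C : {set darc D}) := (fst @: C,
  if [pick e in fst @: C] is Some e then (e, true) \in C else false).
rewrite /directed_knot_count; set KD := [set C | _]%SET.
have KDP C : C \in KD -> is_directed_cycle C /\ knotted doubled C.
  by rewrite inE => /asboolP.
have F_inj : {in KD &, injective F}.
  move=> C C' /KDP[dC kC] /KDP[dC' kC'] [CC'].
  have [_ iC _] := doubled_knotted dC kC.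
  have [_ iC' _] := doubled_knotted dC' kC'.
  rewrite -CC'; case: pickP => [e eC|C0].
    move=> eq.
    have [b bC] : exists b, (e, b) \in C.
      by have /imsetP[[e' b] ebC /= ->] := eC; exists b.
    have [b' bC'] : exists b, (e, b) \in C'.
      by move: eC; rewrite CC' => /imsetP[[e' b'] ebC /= ->]; exists b'.
    (* Both cycles answer alike whether they contain [(e, true)]; if neither does, both contain
       [(e, false)]. *)
    have [a aC aC'] : exists2 a, a \in C & a \in C'.
      case: b bC => bC; first by exists (e, true); rewrite -?eq.
      case: b' bC' => bC'; first by exists (e, true); rewrite ?eq.
      by exists (e, false).
    apply/eqP; rewrite finset.eqEsubset (directed_cycle_sub dC dC' iC CC' aC aC').
    by rewrite (directed_cycle_sub dC' dC iC' (esym CC') aC' aC).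
  have C0' : fst @: C = finset.set0 by apply/setP => e; rewrite inE; exact: C0.
  move=> _; have /eqP := C0'; rewrite imset_eq0 => /eqP ->.
  by move/eqP: C0'; rewrite CC' imset_eq0 => /eqP ->.
rewrite -(card_in_imset F_inj) mulnC.
have -> : 2%N = #|[set: bool]%SET| by rewrite cardsT card_bool.
rewrite /knot_count -cardsX; apply: subset_leq_card.
apply/fintype.subsetP => _ /imsetP[C /KDP[dC kC] ->]; rewrite !inE andbT /=.
by have [cC _ kfC] := doubled_knotted dC kC; apply/asboolP.
Qed.

End DoubledEmbedding.

Theorem proposition7p1 (R : realType) (G : graph) :
  (directed_mnk R (symmetric_digraph G) <= 2 * mnk R G)%N.
Proof.
(* Without tame embeddings the directed minimum runs over the empty set and is 0 by convention. *)
have [[f0 tf0]|none] := pselect (exists f : embedding R G, tame f); last first.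
  rewrite /directed_mnk /minimum (_ : [set n | _] = set0).
    by rewrite xgetPN // => n [].
  apply/seteqP; split=> // n [[g tg _] _].
  by apply: none; exists (restrict_embedding g); exact: restrict_tame.
have ne : [set knot_count f | f in [set f : embedding R G | tame f]] !=set0.
  by exists (knot_count f0); exists f0.
have [[f /= [H aH pH] fE] _] := minimumP ne.
have [ck [k' _ [kK _]]] : homeomorphism (H 1).
  by have [_ _] := aH; apply; rewrite ler01 lexx.
have Hi : isotopic_to_id (H 1) by exists H.
pose f1 := push_embedding f ck (can_inj kK).
have polyf1 e : polygonal (edge_image f1 e) by rewrite push_edge_image.
have [h hP] := parallel_copies_all polyf1.
(* Moving the embedding by an isotopy leaves every knot type, hence the minimal count, unchanged. *)
have fcount : knot_count f1 = knot_count f.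
  rewrite /knot_count; apply: eq_card => C; rewrite !inE.
  apply: asbool_equiv_eq; rewrite /knotted push_cycle_image.
  by split=> -[cC kC]; split=> // tC; apply: kC; apply/(trivial_knot_homeo _ Hi).
have ne' : [set directed_knot_count g | g in
    [set g : embedding R (underlying (symmetric_digraph G)) | tame g]] !=set0.
  by exists (directed_knot_count (doubled hP)), (doubled hP) => //; exact: doubled_tame.
have [_ min] := minimumP ne'.
rewrite /mnk -fE -fcount; apply: leq_trans (doubled_knot_count hP).
by apply: min; exists (doubled hP) => //; exact: doubled_tame.
Qed.
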